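(* Let $p>3$ be prime and $1\le \ell\le p-1$. For every $A=\begin{pmatrix} a&b\\ c&d\end{pmatrix}\in\Gamma_0(p)$, $$\big(\mathcal{F}_1(\ell;z)\big)\big|[A]_1=\mu(A,\ell)\,\mathcal{F}_1(\overline{d\ell};z),\qquad \mu(A,\ell)=\exp\!\left(\pi i\left(\frac{\ell(d-1)}{p}+\frac{cd\ell^2}{p^2}-\frac{c\ell}{p}\right)\right),$$ where $\overline{m}$ denotes the least nonnegative residue of $m$ modulo $p$.
   Context: $z$ lies in the upper half-plane, $q=e^{2\pi i z}$ and $q^r:=e^{2\pi i r z}$ for rational $r$; $\zeta_p=e^{2\pi i/p}$. For $A=\begin{pmatrix} a&b\\ c&d\end{pmatrix}\in SL_2(\mathbb{Z})$ the weight-$k$ slash operator is $(F|[A]_k)(z)=(cz+d)^{-k}F\big(\tfrac{az+b}{cz+d}\big)$. $\eta(z)=q^{1/24}\prod_{n\ge1}(1-q^n)$. For real $g,h$ not both $\equiv 0 \pmod p$, Yang's generalized eta function is $E_{g,h}(z)=q^{B(g/p)/2}\prod_{m\ge1}(1-\zeta_p^{h}q^{m-1+g/p})(1-\zeta_p^{-h}q^{m-g/p})$ with $B(x)=x^2-x+\tfrac16$; in particular $E_{0,\ell}(z)=q^{1/12}\prod_{m\ge1}(1-\zeta_p^{\ell}q^{m-1})(1-\zeta_p^{-\ell}q^{m})$. Define $\mathcal{F}_1(\ell;z)=\eta(z)^2/E_{0,\ell}(z)$ for $1\le\ell\le p-1$. *)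

(* Defs.v *)
From Stdlib Require Import Reals ZArith Znumtheory.
From Coquelicot Require Import Coquelicot.
Open Scope R_scope.

Definition Cexp (z : C) : C :=
  (exp (Re z) * cos (Im z), exp (Re z) * sin (Im z)).

(* limit of a complex sequence, computed componentwise
   (agrees with the usual limit whenever the sequence converges) *)
Definition Clim (u : nat -> C) : C :=
  (real (Lim_seq (fun n => Re (u n))), real (Lim_seq (fun n => Im (u n)))).

Fixpoint Cprod1 (f : nat -> C) (N : nat) : C :=
  match N with
  | O => RtoC 1
  | S n => Cmult (Cprod1 f n) (f (S n))
  end.

Definition Cinfprod (f : nat -> C) : C := Clim (Cprod1 f).

Definition qpow (r : R) (z : C) : C :=
  Cexp (Cmult (Cmult (RtoC (2 * PI * r)) Ci) z).

Definition zetap (p : nat) (h : R) : C :=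
  Cexp (Cmult (RtoC (2 * PI * h / INR p)) Ci).

Definition eta (z : C) : C :=
  Cmult (qpow (1 / 24) z)
        (Cinfprod (fun n => Cminus (RtoC 1) (qpow (INR n) z))).

Definition Bpoly (x : R) : R := x ^ 2 - x + 1 / 6.

(* Yang's generalized eta function E_{g,h} (level p) *)
Definition Egen (p : nat) (g h : R) (z : C) : C :=
  Cmult (qpow (Bpoly (g / INR p) / 2) z)
    (Cinfprod (fun m =>
       Cmult (Cminus (RtoC 1) (Cmult (zetap p h) (qpow (INR m - 1 + g / INR p) z)))
             (Cminus (RtoC 1) (Cmult (zetap p (- h)) (qpow (INR m - g / INR p) z))))).

Definition F1 (p l : nat) (z : C) : C :=
  Cdiv (Cmult (eta z) (eta z)) (Egen p 0 (INR l) z).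

Definition slash1 (F : C -> C) (a b c d : Z) (z : C) : C :=
  let den := Cplus (Cmult (RtoC (IZR c)) z) (RtoC (IZR d)) in
  Cmult (Cinv den)
        (F (Cdiv (Cplus (Cmult (RtoC (IZR a)) z) (RtoC (IZR b))) den)).

Definition muA (p l : nat) (c d : Z) : C :=
  let P := INR p in let L := INR l in
  Cexp (Cmult (RtoC (PI * (L * (IZR d - 1) / P + IZR c * IZR d * L ^ 2 / P ^ 2
                           - IZR c * L / P))) Ci).

Definition resid (p l : nat) (d : Z) : nat :=
  Z.to_nat (Z.modulo (d * Z.of_nat l) (Z.of_nat p)).

(* Main.v *)
Require Import Defs.
From Stdlib Require Import Reals ZArith Znumtheory Lra Lia.
From Coquelicot Require Import Coquelicot.
Open Scope R_scope.

(** Up to elementary factors, [F1 p l z] is the inverse of [psi z (l / p)], where [psi tau u]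
    is the Jacobi theta function [theta_1] normalised to have slope [2 pi i] at [u = 0].
    Everything follows from the quasi-periodicity of [psi] in [u] and from
    [psi (A tau) (u / (c tau + d)) = (c tau + d)^-1 exp (pi i c u^2 / (c tau + d)) psi tau u],
    evaluated at [u = (l / p) (c z + d)], which is [d l / p] plus an integer multiple of [z]
    since [p] divides [c].
    By the Euclidean algorithm on [(c, d)] the law is reduced to [tau -> tau + 1], which is
    clear, and [tau -> -1 / tau].  For the latter both sides are entire in [u] with the same
    multipliers under [u -> u + 1] and [u -> u + tau].  Such functions form a line: shifting
    the contour by [tau] relates consecutive Fourier coefficients on the real line, so one
    coefficient determines all of them.  The constant is found by comparing slopes at 0. *)

(** The quotient defining [F1] is what makes the slope normalisation effective: the factors
    $q^{1/12}$ of [eta] squared and of $E_{0,\ell}$ cancel, and what remains of [eta] squared,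
    [qpoch_sq], is up to $2\pi i$ the slope of [phi] at 0. The constant in the inversion law of
    [phi] contains a ratio of two values of [qpoch_sq]; dividing by the slope turns it into
    $1/\tau$, with no root of unity. The analytic obstacle is that [phi] is an infinite product.
    Differentiation is confined to its partial products, and only the comparison of integrals passes
    to the limit, by locally uniform convergence. Since [phi] changes sign under $u\mapsto u+1$, its
    Fourier expansion has only the odd frequencies $e^{\pi i(2j+1)u}$. Uniqueness of the
    coefficients is therefore tested against $\cos(\pi x)^{2n+1}$: nonnegative on $[-1/2,1/2]$,
    concentrated at 0, and a finite combination of odd exponentials. *)

Lemma C_ext (u v : C) : Re u = Re v -> Im u = Im v -> u = v.
Proof. destruct u, v; simpl; intros; subst; reflexivity. Qed.

Lemma im_le_Cmod (u : C) : Rabs (Im u) <= Cmod u.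
Proof. eapply Rle_trans; [apply Rmax_r | apply (Rmax_Cmod u)]. Qed.

Lemma Cmod_le_re_im (u : C) : Cmod u <= Rabs (Re u) + Rabs (Im u).
Proof.
  replace u with (RtoC (Re u) + Ci * RtoC (Im u))%C at 1
    by (apply C_ext; unfold Ci; simpl; ring).
  eapply Rle_trans; [apply Cmod_triangle|].
  rewrite Cmod_mult, Cmod_Ci, !Cmod_R; lra.
Qed.

Lemma Cmod_minus_sym (u v : C) : Cmod (u - v) = Cmod (v - u).
Proof. rewrite <- Cmod_opp; f_equal; ring. Qed.

Lemma Cinv_0 : (/ 0 = 0)%C.
Proof. apply C_ext; simpl; unfold Rdiv; ring. Qed.

(** With the convention [/ 0 = 0] the rule is unconditional, so reciprocals of [phi] and [psi] split
    without a discussion of their zeros. *)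
Lemma Cinv_mult (u v : C) : (/ (u * v) = / u * / v)%C.
Proof.
  destruct (Ceq_dec u 0) as [->|Hu];
    [rewrite Cmult_0_l, Cinv_0; ring|].
  destruct (Ceq_dec v 0) as [->|Hv];
    [rewrite Cmult_0_r, Cinv_0; ring|].
  field; auto.
Qed.

(** * The complex exponential *)

Lemma Cexp_plus (u v : C) : Cexp (u + v) = (Cexp u * Cexp v)%C.
Proof.
  apply C_ext; unfold Cexp, Re, Im; simpl;
    rewrite exp_plus, ?cos_plus, ?sin_plus; ring.
Qed.

Lemma Cexp_0 : Cexp 0 = 1.
Proof. apply C_ext; unfold Cexp, Re, Im; simpl; rewrite exp_0, ?cos_0, ?sin_0; ring. Qed.

Lemma Cmod_Cexp (u : C) : Cmod (Cexp u) = exp (Re u).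
Proof.
  unfold Cmod; simpl.
  replace (_ + _) with (Rsqr (exp (Re u))).
  - apply sqrt_Rsqr, Rlt_le, exp_pos.
  - pose proof (sin2_cos2 (Im u)) as H; unfold Rsqr in *.
    replace (exp (Re u) * exp (Re u)) with
      (exp (Re u) * exp (Re u) * (sin (Im u) * sin (Im u) + cos (Im u) * cos (Im u)))
      by (rewrite H; ring).
    ring.
Qed.

Lemma Cexp_neq_0 (u : C) : Cexp u <> 0.
Proof. apply Cmod_gt_0; rewrite Cmod_Cexp; apply exp_pos. Qed.

Lemma Cexp_opp (u : C) : Cexp (- u) = (/ Cexp u)%C.
Proof.
  assert (H : (Cexp (- u) * Cexp u = 1)%C)
    by (rewrite <- Cexp_plus, <- Cexp_0; f_equal; ring).
  replace (/ Cexp u)%C with (Cexp (- u) * Cexp u * / Cexp u)%C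
    by (rewrite H; ring).
  field; apply Cexp_neq_0.
Qed.

Lemma Cexp_pow (u : C) (n : nat) : (Cexp u ^ n)%C = Cexp (RtoC (INR n) * u).
Proof.
  induction n as [|n IH].
  - rewrite Cmult_0_l, Cexp_0; reflexivity.
  - rewrite Cpow_S, IH, <- Cexp_plus, S_INR, RtoC_plus; f_equal; ring.
Qed.

Lemma Cmod_Cexp_le (u : C) : Cmod (Cexp u) <= exp (Cmod u).
Proof.
  rewrite Cmod_Cexp.
  assert (H : Re u <= Cmod u)
    by (eapply Rle_trans; [apply Rle_abs | apply re_le_Cmod]).
  destruct (Rle_lt_or_eq_dec _ _ H) as [H'|H'];
    [apply Rlt_le, exp_increasing, H' | rewrite H'; lra].
Qed.

Lemma Cexp_PI : Cexp (RtoC PI * Ci) = (-1)%C.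
Proof.
  apply C_ext; unfold Cexp, Re, Im; simpl;
    replace (PI * 0 - 0 * 1) with 0 by ring;
    replace (PI * 1 + 0 * 0) with PI by ring;
    rewrite exp_0, ?cos_PI, ?sin_PI; ring.
Qed.

Lemma Cexp_2PI_Z (k : Z) : Cexp (RtoC (2 * PI * IZR k) * Ci) = 1.
Proof.
  assert (H : forall n : nat, Cexp (RtoC (2 * PI * INR n) * Ci) = 1).
  { intros n.
    replace (RtoC (2 * PI * INR n) * Ci)%C with (RtoC (INR n) * (RtoC PI * Ci + RtoC PI * Ci))%C
      by (rewrite !RtoC_mult; ring).
    rewrite <- Cexp_pow, Cexp_plus, Cexp_PI.
    replace (-1 * -1)%C with (RtoC 1) by ring; apply Cpow_1_l. }
  destruct (Z.abs_spec k) as [[_ E]|[_ E]].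
  - rewrite <- E, <- (Z2Nat.id (Z.abs k)), <- INR_IZR_INZ by apply Z.abs_nonneg; apply H.
  - replace k with (- Z.abs k)%Z by lia.
    rewrite opp_IZR, <- (Z2Nat.id (Z.abs k)), <- INR_IZR_INZ by apply Z.abs_nonneg.
    replace (RtoC (2 * PI * - INR (Z.to_nat (Z.abs k))) * Ci)%C
      with (- (RtoC (2 * PI * INR (Z.to_nat (Z.abs k))) * Ci))%C
      by (rewrite !RtoC_mult, RtoC_opp; ring).
    rewrite Cexp_opp, H; field; apply C1_nz.
Qed.

(** * Continuity and differentiation by components *)

Definition continuous_C {U : UniformSpace} (h : U -> C) (u : U) : Prop :=
  continuous (fun z => Re (h z)) u /\ continuous (fun z => Im (h z)) u.

Lemma continuous_C_const {U : UniformSpace} (k : C) (u : U) :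
  continuous_C (fun _ : U => k) u.
Proof. split; apply continuous_const. Qed.

Lemma continuous_C_id (u : C) : continuous_C (fun z : C => z) u.
Proof.
  destruct u as [x y]; split.
  - apply (continuous_fst (U := R_UniformSpace) (V := R_UniformSpace) x y).
  - apply (continuous_snd (U := R_UniformSpace) (V := R_UniformSpace) x y).
Qed.

Lemma continuous_C_plus {U : UniformSpace} (f g : U -> C) (u : U) :
  continuous_C f u -> continuous_C g u -> continuous_C (fun z => f z + g z)%C u.
Proof.
  intros [F1 F2] [G1 G2]; split; simpl.
  - apply (continuous_plus (V := R_NormedModule) (fun z => Re (f z)) (fun z => Re (g z)));
    assumption.
  - apply (continuous_plus (V := R_NormedModule) (fun z => Im (f z)) (fun z => Im (g z)));
    assumption.
Qed.

Lemma continuous_C_mult {U : UniformSpace} (f g : U -> C) (u : U) :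
  continuous_C f u -> continuous_C g u -> continuous_C (fun z => f z * g z)%C u.
Proof.
  intros [F1 F2] [G1 G2]; split; simpl.
  - apply (continuous_minus (V := R_NormedModule)
      (fun z => Re (f z) * Re (g z)) (fun z => Im (f z) * Im (g z)));
    apply (continuous_mult (K := R_AbsRing)); assumption.
  - apply (continuous_plus (V := R_NormedModule)
      (fun z => Re (f z) * Im (g z)) (fun z => Im (f z) * Re (g z)));
    apply (continuous_mult (K := R_AbsRing)); assumption.
Qed.

Lemma continuous_C_minus {U : UniformSpace} (f g : U -> C) (u : U) :
  continuous_C f u -> continuous_C g u -> continuous_C (fun z => f z - g z)%C u.
Proof.
  intros [F1 F2] [G1 G2]; split; simpl.
  - apply (continuous_minus (V := R_NormedModule) (fun z => Re (f z)) (fun z => Re (g z)));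
    assumption.
  - apply (continuous_minus (V := R_NormedModule) (fun z => Im (f z)) (fun z => Im (g z)));
    assumption.
Qed.

Lemma continuous_C_Cexp {U : UniformSpace} (f : U -> C) (u : U) :
  continuous_C f u -> continuous_C (fun z => Cexp (f z)) u.
Proof.
  intros [F1 F2]; split; simpl; apply (continuous_mult (K := R_AbsRing)).
  - apply (continuous_comp (fun z => Re (f z)) exp); [assumption|apply continuous_exp].
  - apply (continuous_comp (fun z => Im (f z)) cos); [assumption|apply continuous_cos].
  - apply (continuous_comp (fun z => Re (f z)) exp); [assumption|apply continuous_exp].
  - apply (continuous_comp (fun z => Im (f z)) sin); [assumption|apply continuous_sin].
Qed.

Lemma continuous_C_comp {U : UniformSpace} (f : C -> C) (h : U -> C) (u : U) :
  continuous_C h u -> continuous_C f (h u) -> continuous_C (fun z => f (h z)) u.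
Proof.
  intros [H1 H2] [F1 F2]; split.
  - apply (continuous_comp (V := C_UniformSpace) h (fun z => Re (f z))); [|assumption].
    apply (continuous_ext (fun z => (Re (h z), Im (h z)))); [intros; now destruct (h x)|].
    apply (continuous_comp_2 (fun z => Re (h z)) (fun z => Im (h z))
      (fun a b => (a, b))); try assumption.
    apply (continuous_ext (fun z => z)); [now intros []|]. apply continuous_id.
  - apply (continuous_comp (V := C_UniformSpace) h (fun z => Im (f z))); [|assumption].
    apply (continuous_ext (fun z => (Re (h z), Im (h z)))); [intros; now destruct (h x)|].
    apply (continuous_comp_2 (fun z => Re (h z)) (fun z => Im (h z))
      (fun a b => (a, b))); try assumption.
    apply (continuous_ext (fun z => z)); [now intros []|]. apply continuous_id.
Qed.

Definition is_derive_C (g : R -> C) (t : R) (l : C) : Prop :=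
  is_derive (fun s : R => Re (g s)) t (Re l) /\ is_derive (fun s : R => Im (g s)) t (Im l).

Lemma is_derive_C_mult (f g : R -> C) (t : R) (a b : C) :
  is_derive_C f t a -> is_derive_C g t b ->
  is_derive_C (fun s => f s * g s)%C t (a * g t + f t * b)%C.
Proof.
  (* [e] is the sign of the second product: -1 for real parts, 1 for imaginary parts. *)
  assert (H : forall (f g h k : R -> R) a b c d e,
    is_derive f t a -> is_derive g t b -> is_derive h t c -> is_derive k t d ->
    is_derive (fun s => f s * g s + e * (h s * k s)) t
      (a * g t + f t * b + e * (c * k t + h t * d))).
  { clear; intros f g h k a b c d e F G H K.
    auto_derive; [repeat split; eexists; eassumption|].
    rewrite (is_derive_unique (fun s : R => f s) _ _ F),
      (is_derive_unique (fun s : R => g s) _ _ G), (is_derive_unique (fun s : R => h s) _ _ H),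
      (is_derive_unique (fun s : R => k s) _ _ K); ring. }
  intros [F1 F2] [G1 G2]; split.
  - generalize (H _ _ _ _ _ _ _ _ (-1) F1 G1 F2 G2); intros H'.
    replace (Re (a * g t + f t * b)%C) with
      (Re a * Re (g t) + Re (f t) * Re b + -1 * (Im a * Im (g t) + Im (f t) * Im b))
      by (unfold Re, Im; simpl; ring).
    eapply is_derive_ext; [|exact H']; intros; unfold Re, Im; simpl; ring.
  - generalize (H _ _ _ _ _ _ _ _ 1 F1 G2 F2 G1); intros H'.
    replace (Im (a * g t + f t * b)%C) with
      (Re a * Im (g t) + Re (f t) * Im b + 1 * (Im a * Re (g t) + Im (f t) * Re b))
      by (unfold Re, Im; simpl; ring).
    eapply is_derive_ext; [|exact H']; intros; unfold Re, Im; simpl; ring.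
Qed.

Lemma is_derive_C_plus (f g : R -> C) (t : R) (a b : C) :
  is_derive_C f t a -> is_derive_C g t b ->
  is_derive_C (fun s => f s + g s)%C t (a + b)%C.
Proof.
  intros [F1 F2] [G1 G2]; split; simpl.
  - apply (is_derive_plus (V := R_NormedModule) (fun s => Re (f s)) (fun s => Re (g s)));
    assumption.
  - apply (is_derive_plus (V := R_NormedModule) (fun s => Im (f s)) (fun s => Im (g s)));
    assumption.
Qed.

Lemma is_derive_C_Cexp (f : R -> C) (t : R) (a : C) :
  is_derive_C f t a -> is_derive_C (fun s => Cexp (f s)) t (a * Cexp (f t))%C.
Proof.
  intros [F1 F2].
  assert (H : forall (f g : R -> R) a b, is_derive f t a -> is_derive g t b ->
    is_derive (fun s => exp (f s) * cos (g s)) t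
      (a * (exp (f t) * cos (g t)) - b * (exp (f t) * sin (g t))) /\
    is_derive (fun s => exp (f s) * sin (g s)) t
      (a * (exp (f t) * sin (g t)) + b * (exp (f t) * cos (g t)))).
  { clear; intros f g a b F G.
    split; (auto_derive; [repeat split; eexists; eassumption|]);
    rewrite (is_derive_unique (fun s : R => f s) _ _ F), (is_derive_unique (fun s : R => g s) _ _ G); ring. }
  destruct (H _ _ _ _ F1 F2) as [H1 H2]; split; [exact H1|].
  unfold is_derive_C in *; simpl in *.
  exact H2.
Qed.

(* Complex differentiability is only asked along real lines, which makes products and
   exponentials accessible to real calculus.  The bound on discs follows from continuity
   by compactness; carrying it along is cheaper. *)
Definition entire (f : C -> C) : Prop :=
  (forall u, continuous_C f u) /\
  (forall rho, exists M, forall u, Cmod u <= rho -> Cmod (f u) <= M) /\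
  exists f' : C -> C, (forall u, continuous_C f' u) /\
    forall (u v : C) (t : R),
      is_derive_C (fun s => f (u + RtoC s * v)%C) t (v * f' (u + RtoC t * v)%C).

Lemma entire_const (k : C) : entire (fun _ => k).
Proof.
  repeat split; try apply continuous_const.
  - intros rho; exists (Cmod k); intros; lra.
  - exists (fun _ => 0); split; [intros; apply continuous_C_const|].
    intros; rewrite Cmult_0_r; split; apply (is_derive_const (V := R_NormedModule)).
Qed.

Lemma entire_id : entire (fun u => u).
Proof.
  split; [exact continuous_C_id|split].
  - intros rho; exists rho; auto.
  - exists (fun _ => 1); split; [intros; apply continuous_C_const|].
    intros u v t; split; simpl; auto_derive; trivial; unfold Re, Im; ring.
Qed.

Lemma entire_plus (f g : C -> C) :
  entire f -> entire g -> entire (fun u => f u + g u)%C.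
Proof.
  intros (F1 & F2 & f' & F3 & F4) (G1 & G2 & g' & G3 & G4).
  split; [intros; now apply continuous_C_plus|split].
  - intros rho; destruct (F2 rho) as [M HM], (G2 rho) as [N HN].
    exists (M + N); intros u Hu; eapply Rle_trans; [apply Cmod_triangle|].
    apply Rplus_le_compat; auto.
  - exists (fun u => f' u + g' u)%C; split; [intros; now apply continuous_C_plus|].
    intros; rewrite Cmult_plus_distr_l; now apply is_derive_C_plus.
Qed.

Lemma entire_mult (f g : C -> C) :
  entire f -> entire g -> entire (fun u => f u * g u)%C.
Proof.
  intros (F1 & F2 & f' & F3 & F4) (G1 & G2 & g' & G3 & G4).
  split; [intros; now apply continuous_C_mult|split].
  - intros rho; destruct (F2 rho) as [M HM], (G2 rho) as [N HN].
    exists (M * N); intros u Hu; rewrite Cmod_mult.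
    apply Rmult_le_compat; auto; apply Cmod_ge_0.
  - exists (fun u => f' u * g u + f u * g' u)%C; split.
    + intros; apply continuous_C_plus; now apply continuous_C_mult.
    + intros u v t.
      replace (v * _)%C with
        ((v * f' (u + RtoC t * v)) * g (u + RtoC t * v)
          + f (u + RtoC t * v) * (v * g' (u + RtoC t * v)))%C by ring.
      now apply (is_derive_C_mult (fun s => f (u + RtoC s * v)%C)).
Qed.

Lemma entire_Cexp (f : C -> C) : entire f -> entire (fun u => Cexp (f u)).
Proof.
  intros (F1 & F2 & f' & F3 & F4).
  split; [intros; now apply continuous_C_Cexp|split].
  - intros rho; destruct (F2 rho) as [M HM].
    exists (exp M); intros u Hu; eapply Rle_trans; [apply Cmod_Cexp_le|].
    destruct (Rle_lt_or_eq_dec _ _ (HM u Hu)) as [H|H];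
      [apply Rlt_le, exp_increasing, H | rewrite H; lra].
  - exists (fun u => f' u * Cexp (f u))%C; split.
    + intros; apply continuous_C_mult; [apply F3 | now apply continuous_C_Cexp].
    + intros u v t; rewrite Cmult_assoc.
      now apply (is_derive_C_Cexp (fun s => f (u + RtoC s * v)%C)).
Qed.

Lemma entire_ext (f g : C -> C) : (forall u, f u = g u) -> entire f -> entire g.
Proof.
  intros E (F1 & F2 & f' & F3 & F4); split; [|split].
  - intros u; destruct (F1 u) as [A B]; split;
      [apply continuous_ext with (2 := A) | apply continuous_ext with (2 := B)];
      intros; simpl; now rewrite E.
  - intros rho; destruct (F2 rho) as [M HM]; exists M; intros; rewrite <- E; auto.
  - exists f'; split; [assumption|]; intros u v t; destruct (F4 u v t) as [A B]; split;
      [apply is_derive_ext with (2 := A) | apply is_derive_ext with (2 := B)];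
      intros; simpl; now rewrite E.
Qed.

(** * Contour shift *)

Lemma continuous_C_RtoC {U : UniformSpace} (g : U -> R) (u : U) :
  continuous g u -> continuous_C (fun z => RtoC (g z)) u.
Proof. intros H; split; [exact H | apply continuous_const]. Qed.

Lemma continuous_C_line (f : C -> C) (w v : C) (t : R) :
  (forall u, continuous_C f u) -> continuous_C (fun s : R => f (w + RtoC s * v)%C) t.
Proof.
  intros F; apply (continuous_C_comp f (fun s : R => (w + RtoC s * v)%C)); [|apply F].
  apply continuous_C_plus; [apply continuous_C_const|].
  apply continuous_C_mult; [|apply continuous_C_const].
  apply (continuous_C_RtoC (U := R_UniformSpace)), continuous_id.
Qed.

Lemma ex_RInt_continuous_all (f : R -> R) (a b : R) :
  (forall x, continuous f x) -> ex_RInt f a b.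
Proof. intros H; apply (ex_RInt_continuous (V := R_CompleteNormedModule)); auto. Qed.

Lemma continuous_Re_line (f : C -> C) (w v : C) (t : R) :
  (forall u, continuous_C f u) -> continuous (fun s : R => Re (f (w + RtoC s * v)%C)) t.
Proof. intros F; apply (continuous_C_line f w v t F). Qed.

Lemma continuous_Re_line1 (f : C -> C) (w : C) (t : R) :
  (forall u, continuous_C f u) -> continuous (fun s : R => Re (f (w + RtoC s)%C)) t.
Proof.
  intros F; apply (continuous_ext (fun s : R => Re (f (w + RtoC s * 1)%C)));
    [intros; now rewrite Cmult_1_r | now apply continuous_Re_line].
Qed.

Lemma continuous_Re_increment (f : C -> C) (w w' v : C) (t : R) :
  (forall u, continuous_C f u) ->
  continuous (fun s : R => Re (v * (f (w + RtoC s * v) - f (w' + RtoC s * v)))%C) t.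
Proof.
  intros F.
  assert (H : continuous_C
    (fun s : R => (v * (f (w + RtoC s * v) - f (w' + RtoC s * v)))%C) t).
  { refine (continuous_C_mult (U := R_UniformSpace) (fun _ => v)
      (fun s => (f (w + RtoC s * v) - f (w' + RtoC s * v))%C) t _ _).
    - apply continuous_C_const.
    - refine (continuous_C_minus (U := R_UniformSpace) (fun s => f (w + RtoC s * v)%C)
        (fun s => f (w' + RtoC s * v)%C) t _ _); now apply continuous_C_line. }
  exact (proj1 H).
Qed.

(* Both partial derivatives of [f (w + x + t v)] come from the same [f'], so the
   derivative in [t] of the integral over [x] is an increment in [x]. *)
Lemma contour_shift (f : C -> C) (w v : C) (a b : R) :
  entire f ->
  RInt (fun x => Re (f (w + v + RtoC x)%C)) a b - RInt (fun x => Re (f (w + RtoC x)%C)) a b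
  = RInt (fun t => Re (v * (f (w + RtoC b + RtoC t * v) - f (w + RtoC a + RtoC t * v)))%C) 0 1.
Proof.
  intros (F1 & _ & f' & F3 & F4).
  set (F := fun t x : R => Re (f (w + RtoC x + RtoC t * v)%C)).
  assert (DF : forall t x, is_derive (fun s => F s x) t
                 (Re (v * f' (w + RtoC x + RtoC t * v)%C))).
  { intros t x; apply (F4 (w + RtoC x)%C v t). }
  assert (E : forall t x, (w + RtoC x + RtoC t * v)%C = (w + RtoC t * v + RtoC x * 1)%C)
    by (intros; ring).
  assert (DP : forall t, is_derive (fun s => RInt (F s) a b) t
    (Re (v * (f (w + RtoC b + RtoC t * v) - f (w + RtoC a + RtoC t * v)))%C)).
  { intros t.
    assert (I : is_RInt (fun x => Derive (fun s => F s x) t) a b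
      (Re (v * (f (w + RtoC b + RtoC t * v) - f (w + RtoC a + RtoC t * v)))%C)).
    { apply (is_RInt_ext (fun x => Re (v * f' (w + RtoC t * v + RtoC x * 1))%C)).
      { intros x _; rewrite <- E; symmetry; apply is_derive_unique, DF. }
      rewrite !E.
      replace (Re (v * _)%C) with
        (minus (Re (v * f (w + RtoC t * v + RtoC b * 1)))%C
           (Re (v * f (w + RtoC t * v + RtoC a * 1)))%C)
        by (unfold minus, plus, opp, Re; simpl; ring).
      apply (is_RInt_derive (V := R_CompleteNormedModule)
        (fun x => Re (v * f (w + RtoC t * v + RtoC x * 1))%C)).
      - intros x _.
        destruct (is_derive_C_mult (fun _ => v) (fun x => f (w + RtoC t * v + RtoC x * 1)%C)
          x 0 (1 * f' (w + RtoC t * v + RtoC x * 1))%C) as [H _].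
        + split; apply (is_derive_const (V := R_NormedModule)).
        + apply F4.
        + replace (v * f' (w + RtoC t * v + RtoC x * 1))%C with
            (0 * f (w + RtoC t * v + RtoC x * 1)
             + v * (1 * f' (w + RtoC t * v + RtoC x * 1)))%C by ring.
          exact H.
      - intros x _.
        apply (continuous_Re_line (fun u => v * f' u)%C).
        intros; apply continuous_C_mult; [apply continuous_C_const | apply F3]. }
    rewrite <- (is_RInt_unique _ _ _ _ I).
    apply is_derive_RInt_param.
    - apply filter_forall; intros s x _; eexists; apply DF.
    - intros x _.
      apply continuity_2d_pt_ext with (fun s x => Re (v * f' (w + RtoC x + RtoC s * v))%C).
      { intros s y; symmetry; apply is_derive_unique, DF. }
      apply continuity_2d_pt_filterlim.
      apply (continuous_C_mult (U := prod_UniformSpace R_UniformSpace R_UniformSpace)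
        (fun _ => v) (fun z => f' (w + RtoC (snd z) + RtoC (fst z) * v)%C) (t, x)).
      + apply continuous_C_const.
      + apply (continuous_C_comp (U := prod_UniformSpace R_UniformSpace R_UniformSpace) f'
          (fun z => (w + RtoC (snd z) + RtoC (fst z) * v)%C)); [|apply F3].
        apply continuous_C_plus; [apply continuous_C_plus|apply continuous_C_mult];
          try apply continuous_C_const; apply continuous_C_RtoC.
        * apply (continuous_snd (U := R_UniformSpace) (V := R_UniformSpace) t x).
        * apply (continuous_fst (U := R_UniformSpace) (V := R_UniformSpace) t x).
    - apply filter_forall; intros s; apply ex_RInt_continuous_all; intros x.
      apply (continuous_ext (fun x : R => Re (f (w + RtoC s * v + RtoC x * 1)%C))).
      { intros; unfold F; now rewrite E. }
      now apply continuous_Re_line. }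
  symmetry; apply is_RInt_unique.
  replace (_ - _) with (minus (RInt (F 1) a b) (RInt (F 0) a b)).
  - apply (is_RInt_derive (V := R_CompleteNormedModule) (fun t => RInt (F t) a b)).
    + intros t _; apply DP.
    + intros t _.
      now apply continuous_Re_increment.
  - unfold minus, plus, opp, F; simpl; unfold Rminus; f_equal; [|f_equal];
      apply RInt_ext; intros; do 2 f_equal; ring.
Qed.

(** * Uniqueness of Fourier coefficients *)

(* The powers of [cos (PI * x)] concentrate at [x = 0]: if [h 0 > 0], the integral over
   [|x| <= d / 2] eventually dominates the rest. *)
Lemma nonpos_of_cos_kernel (h : R -> R) :
  (forall x, continuous h x) ->
  (forall n, RInt (fun x => h x * cos (PI * x) ^ (2 * n + 1)) (-1/2) (1/2) = 0) ->
  h 0 <= 0.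
Proof.
  intros Hc HI; apply Rnot_lt_le; intros H0.
  assert (PI0 := PI_RGT_0).
  destruct (bounded_continuity (V := R_NormedModule) h (-1/2) (1/2)) as [M HM];
    [intros; apply Hc|].
  assert (HM0 : 0 < M).
  { eapply Rle_lt_trans; [|apply (HM 0); lra]. apply norm_ge_0. }
  (* The bound 1/4 keeps [PI * d] where the cosine is positive and decreasing. *)
  assert (Hd : exists d, 0 < d <= 1/4 /\ forall x, -d <= x <= d -> h 0 / 2 <= h x).
  { assert (He : 0 < h 0 / 2) by lra.
    destruct (proj1 (filterlim_locally h (h 0)) (Hc 0) (mkposreal _ He)) as [d Hd].
    exists (Rmin (d / 2) (1/4)).
    assert (H1 := Rmin_l (d / 2) (1/4)); assert (H2 := Rmin_r (d / 2) (1/4)).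
    assert (H3 : 0 < Rmin (d / 2) (1/4)) by (apply Rmin_pos; [destruct d; simpl|]; lra).
    split; [lra|]; intros x Hx.
    assert (B : ball 0 d x).
    { apply Rabs_def1; unfold minus, plus, opp; simpl; destruct d; simpl in *; lra. }
    specialize (Hd x B); apply Rabs_def2 in Hd; unfold minus, plus, opp in Hd; simpl in Hd.
    lra. }
  destruct Hd as (d & Hd & Hh).
  (* [c1] bounds the cosine below on the half-size neighbourhood, [c2] bounds it above outside the
     full one; the strict gap makes the ratio of their powers diverge. *)
  set (c1 := cos (PI * (d / 2))); set (c2 := cos (PI * d)).
  assert (Hc2 : 0 < c2) by (apply cos_gt_0; nra).
  assert (Hc1 : c2 < c1) by (apply cos_decreasing_1; nra).
  assert (Hcos : forall x, -1/2 <= x <= 1/2 -> 0 <= cos (PI * x)) by (intros; apply cos_ge_0; nra).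
  assert (cosabs : forall x, cos (PI * x) = cos (PI * Rabs x)).
  { intros x; unfold Rabs; destruct (Rcase_abs x); [|reflexivity].
    rewrite <- cos_neg; f_equal; ring. }
  assert (Hout : forall x, -1/2 <= x <= 1/2 -> d <= Rabs x -> cos (PI * x) <= c2).
  { intros x Hx Hdx; rewrite cosabs.
    assert (Rabs x <= 1/2) by (apply Rabs_le; lra).
    apply cos_decr_1; nra. }
  assert (Hin : forall x, - (d / 2) <= x <= d / 2 -> c1 <= cos (PI * x)).
  { intros x Hx; rewrite cosabs.
    assert (Rabs x <= d / 2) by (apply Rabs_le; lra).
    assert (0 <= Rabs x) by apply Rabs_pos.
    apply cos_decr_1; nra. }
  assert (Hmain : forall n, d * (h 0 / 2 * c1 ^ (2 * n + 1)) <= M * c2 ^ (2 * n + 1)).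
  { intros n; set (k := (2 * n + 1)%nat).
    set (f := fun x => h x * cos (PI * x) ^ k).
    assert (Hf : forall x, continuous f x).
    { intros x; apply (continuous_mult (K := R_AbsRing)); [apply Hc|].
      apply (ex_derive_continuous (fun x => cos (PI * x) ^ k)); auto_derive; trivial. }
    assert (Hex : forall a b, ex_RInt f a b) by (intros; now apply ex_RInt_continuous_all).
    assert (Hlow : forall x, -1/2 <= x <= 1/2 -> - (M * c2 ^ k) <= f x).
    { intros x Hx; unfold f.
      assert (0 < c2 ^ k) by now apply pow_lt.
      assert (0 <= cos (PI * x) ^ k) by (apply pow_le; auto).
      destruct (Rle_lt_dec d (Rabs x)) as [Hx'|Hx'].
      - assert (cos (PI * x) ^ k <= c2 ^ k) by (apply pow_incr; auto).
        specialize (HM x Hx); apply Rabs_def2 in HM.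
        unfold f; nra.
      - assert (h 0 / 2 <= h x) by (apply Hh; apply Rabs_def2 in Hx'; lra).
        apply Rle_trans with 0; nra. }
    assert (Hlow' : forall x, - (d / 2) <= x <= d / 2 -> h 0 / 2 * c1 ^ k <= f x).
    { intros x Hx; unfold f; apply Rmult_le_compat; try lra.
      - apply pow_le; lra.
      - apply Hh; lra.
      - apply pow_incr; split; [lra | now apply Hin]. }
    assert (I1 : (- (d / 2) + 1/2) * - (M * c2 ^ k) <= RInt f (-1/2) (- (d / 2))).
    { replace ((- (d / 2) + 1/2) * - (M * c2 ^ k))
        with (RInt (fun _ => - (M * c2 ^ k)) (-1/2) (- (d / 2)))
        by (rewrite (RInt_const (V := R_CompleteNormedModule)); unfold scal; simpl;
            unfold mult; simpl; field).
      apply RInt_le; [lra|apply ex_RInt_const|apply Hex|intros; apply Hlow; lra]. }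
    assert (I2 : d * (h 0 / 2 * c1 ^ k) <= RInt f (- (d / 2)) (d / 2)).
    { replace (d * (h 0 / 2 * c1 ^ k))
        with (RInt (fun _ => h 0 / 2 * c1 ^ k) (- (d / 2)) (d / 2))
        by (rewrite (RInt_const (V := R_CompleteNormedModule)); unfold scal; simpl;
            unfold mult; simpl; field).
      apply RInt_le; [lra|apply ex_RInt_const|apply Hex|intros; apply Hlow'; lra]. }
    assert (I3 : (- (d / 2) + 1/2) * - (M * c2 ^ k) <= RInt f (d / 2) (1/2)).
    { replace ((- (d / 2) + 1/2) * - (M * c2 ^ k))
        with (RInt (fun _ => - (M * c2 ^ k)) (d / 2) (1/2))
        by (rewrite (RInt_const (V := R_CompleteNormedModule)); unfold scal; simpl;
            unfold mult; simpl; field).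
      apply RInt_le; [lra|apply ex_RInt_const|apply Hex|intros; apply Hlow; lra]. }
    assert (S := HI n); fold k f in S.
    rewrite <- (RInt_Chasles (V := R_CompleteNormedModule) f (-1/2) (- (d / 2))),
      <- (RInt_Chasles (V := R_CompleteNormedModule) f (- (d / 2)) (d / 2)) in S by apply Hex.
    unfold plus in S; simpl in S.
    assert (0 < M * c2 ^ k) by (apply Rmult_lt_0_compat; [|apply pow_lt]; lra).
    nra. }
  set (r := c1 / c2).
  assert (Hr : Rabs r > 1).
  { rewrite Rabs_pos_eq; unfold r; [apply Rlt_div_r | apply Rlt_le, Rdiv_lt_0_compat]; lra. }
  (* The threshold exceeds by 1 the upper bound on [r ^ (2 * N + 1)] that [Hmain] yields. *)
  destruct (Pow_x_infinity r Hr (M / (d * (h 0 / 2)) + 1)) as [N HN].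
  specialize (HN (2 * N + 1)%nat ltac:(lia)); specialize (Hmain N).
  rewrite Rabs_pos_eq in HN
    by (apply pow_le; unfold r; apply Rlt_le, Rdiv_lt_0_compat; lra).
  replace c1 with (r * c2) in Hmain by (unfold r; field; lra).
  rewrite Rpow_mult_distr in Hmain.
  assert (0 < c2 ^ (2 * N + 1)) by now apply pow_lt.
  assert (Hdh : 0 < d * (h 0 / 2)) by nra.
  assert (d * (h 0 / 2) * r ^ (2 * N + 1) <= M).
  { apply Rmult_le_reg_r with (c2 ^ (2 * N + 1)); nra. }
  assert (d * (h 0 / 2) * (M / (d * (h 0 / 2)) + 1) <= M) by nra.
  replace (d * (h 0 / 2) * (M / (d * (h 0 / 2)) + 1)) with (M + d * (h 0 / 2)) in * by (field; lra).
  lra.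
Qed.

Lemma zero_of_cos_kernel (h : R -> R) :
  (forall x, continuous h x) ->
  (forall n, RInt (fun x => h x * cos (PI * x) ^ (2 * n + 1)) (-1/2) (1/2) = 0) ->
  h 0 = 0.
Proof.
  intros Hc HI; apply Rle_antisym; [now apply nonpos_of_cos_kernel|].
  enough (- h 0 <= 0) by lra.
  apply (nonpos_of_cos_kernel (fun x => - h x)).
  - intros x; apply (continuous_opp (V := R_NormedModule)), Hc.
  - intros n; rewrite <- (Rmult_0_r (-1)), <- (HI n).
    rewrite <- (RInt_scal (V := R_CompleteNormedModule)).
    + apply RInt_ext; intros; unfold scal; simpl; unfold mult; simpl; ring.
    + apply ex_RInt_continuous_all; intros x.
      apply (continuous_mult (K := R_AbsRing)); [apply Hc|].
      apply (ex_derive_continuous (fun x => cos (PI * x) ^ (2 * n + 1))); auto_derive; trivial.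
Qed.

(** * Locally uniform limits of entire functions *)

(** The approximants carry the derivatives; the limit is used only through its values. The bound
    uniform in [n] makes the class closed under products. *)
Definition limit_of_entire (f : C -> C) : Prop :=
  exists F : nat -> C -> C, (forall n, entire (F n)) /\
    forall rho,
      (exists M, forall n u, Cmod u <= rho -> Cmod (F n u) <= M) /\
      (forall eps, 0 < eps -> exists N, forall n u, (N <= n)%nat ->
         Cmod u <= rho -> Cmod (F n u - f u) <= eps).

Lemma limit_of_entire_entire (f : C -> C) : entire f -> limit_of_entire f.
Proof.
  intros Hf; exists (fun _ => f); split; [auto|]; intros rho; split.
  - destruct Hf as (_ & Hb & _); destruct (Hb rho) as [M HM]; exists M; auto.
  - intros eps He; exists O; intros.
    replace (f u - f u)%C with (RtoC 0) by ring; rewrite Cmod_0; lra.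
Qed.

Lemma limit_of_entire_plus (f g : C -> C) :
  limit_of_entire f -> limit_of_entire g -> limit_of_entire (fun u => f u + g u)%C.
Proof.
  intros (F & F1 & F2) (G & G1 & G2); exists (fun n u => F n u + G n u)%C; split.
  { intros; now apply entire_plus. }
  intros rho; destruct (F2 rho) as [[M HM] F3], (G2 rho) as [[N HN] G3]; split.
  - exists (M + N); intros; eapply Rle_trans; [apply Cmod_triangle|].
    apply Rplus_le_compat; auto.
  - intros eps He; destruct (F3 (eps / 2)) as [P HP], (G3 (eps / 2)) as [Q HQ]; try lra.
    exists (P + Q)%nat; intros n u Hn Hu.
    replace (_ - _)%C with ((F n u - f u) + (G n u - g u))%C by ring.
    eapply Rle_trans; [apply Cmod_triangle|].
    specialize (HP n u ltac:(lia) Hu); specialize (HQ n u ltac:(lia) Hu); lra.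
Qed.

Lemma limit_of_entire_bounded (f : C -> C) (rho : R) :
  limit_of_entire f -> exists M, 0 < M /\ forall u, Cmod u <= rho -> Cmod (f u) <= M.
Proof.
  intros (F & F1 & F2); destruct (F2 rho) as [[M HM] F3].
  destruct (F3 1 Rlt_0_1) as [N HN].
  exists (Rabs M + 1); split; [pose proof (Rabs_pos M); lra|]; intros u Hu.
  replace (f u) with (F N u + - (F N u - f u))%C by ring.
  eapply Rle_trans; [apply Cmod_triangle|]; rewrite Cmod_opp.
  specialize (HN N u (le_n _) Hu); specialize (HM N u Hu); pose proof (Rle_abs M); lra.
Qed.

Lemma limit_of_entire_mult (f g : C -> C) :
  limit_of_entire f -> limit_of_entire g -> limit_of_entire (fun u => f u * g u)%C.
Proof.
  intros Hf Hg; assert (Hf' := Hf); destruct Hf as (F & F1 & F2), Hg as (G & G1 & G2).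
  exists (fun n u => F n u * G n u)%C; split.
  { intros; now apply entire_mult. }
  intros rho; destruct (F2 rho) as [[M HM] F3], (G2 rho) as [[N HN] G3]; split.
  - exists (M * N); intros; rewrite Cmod_mult; apply Rmult_le_compat; auto; apply Cmod_ge_0.
  - intros eps He; destruct (limit_of_entire_bounded f rho Hf') as (K & K0 & HK).
    set (L := K + Rabs N + 1).
    assert (HL : 0 < L /\ K <= L /\ N <= L)
      by (unfold L; pose proof (Rabs_pos N); pose proof (Rle_abs N); lra).
    assert (He' : 0 < eps / (2 * L)) by (apply Rdiv_lt_0_compat; lra).
    destruct (F3 _ He') as [P HP], (G3 _ He') as [Q HQ].
    exists (P + Q)%nat; intros n u Hn Hu.
    replace (_ - _)%C with ((F n u - f u) * G n u + f u * (G n u - g u))%C by ring.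
    eapply Rle_trans; [apply Cmod_triangle|]; rewrite !Cmod_mult.
    specialize (HP n u ltac:(lia) Hu); specialize (HQ n u ltac:(lia) Hu).
    specialize (HK u Hu); specialize (HN n u Hu).
    replace eps with (eps / (2 * L) * L + L * (eps / (2 * L))) by (field; lra).
    apply Rplus_le_compat; apply Rmult_le_compat; try apply Cmod_ge_0; lra.
Qed.

Lemma limit_of_entire_scal (k : C) (f : C -> C) :
  limit_of_entire f -> limit_of_entire (fun u => k * f u)%C.
Proof.
  apply (limit_of_entire_mult (fun _ => k)), limit_of_entire_entire, entire_const.
Qed.

(** [limit_of_entire] is stable under multiplication by [- Ci], so statements proved for real parts
    transfer to imaginary parts. *)
Lemma Im_Re (u : C) : Im u = Re (- Ci * u)%C.
Proof. unfold Re, Im; simpl; ring. Qed.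

Lemma limit_of_entire_continuous (f : C -> C) :
  limit_of_entire f -> forall u : C, continuous_C f u.
Proof.
  assert (H : forall f, limit_of_entire f -> forall u : C,
    continuous (fun z : C_UniformSpace => Re (f z)) u).
  { clear; intros f (F & F1 & F2) u.
    apply filterlim_locally; intros eps.
    (* Balls of [C_UniformSpace] are squares: in the unit ball at [u] both components move by less
       than 1, hence the modulus by less than 2. *)
    destruct (F2 (Cmod u + 2)) as [_ F3].
    assert (He : 0 < eps / 4) by (destruct eps; simpl; lra).
    destruct (F3 _ He) as [N HN].
    destruct (F1 N) as (Fc & _); destruct (Fc u) as [Fc' _].
    apply (proj1 (filterlim_locally (F := locally u) (fun z => Re (F N z)) _))
      with (eps := mkposreal _ He) in Fc'.
    assert (B : locally (T := C_UniformSpace) u (fun z => Cmod z <= Cmod u + 2)).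
    { exists (mkposreal 1 Rlt_0_1); intros z [B1 B2].
      replace z with (u + (z - u))%C by ring.
      eapply Rle_trans; [apply Cmod_triangle|]; apply Rplus_le_compat_l.
      eapply Rle_trans; [apply Cmod_le_re_im|].
      change (Rabs (Re (z - u)%C) < 1) in B1; change (Rabs (Im (z - u)%C) < 1) in B2.
      lra. }
    generalize (filter_and _ _ Fc' B); apply filter_imp; intros z [Z1 Z2].
    change (Rabs (Re (F N z) - Re (F N u)) < eps / 4) in Z1.
    change (Rabs (Re (f z) - Re (f u)) < eps).
    assert (A1 := HN N z (le_n _) Z2).
    assert (A2 := HN N u (le_n _) ltac:(lra)).
    assert (A3 := Rle_trans _ _ _ (re_le_Cmod _) A1).
    assert (A4 := Rle_trans _ _ _ (re_le_Cmod _) A2).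
    unfold Re in *; simpl in A3, A4.
    apply Rabs_def2 in Z1; apply Rabs_le_between in A3; apply Rabs_le_between in A4.
    apply Rabs_def1; lra. }
  intros Hf u; split; [now apply H|].
  apply (continuous_ext (fun z => Re (- Ci * f z)%C)); [intros; now rewrite Im_Re|].
  now apply (H (fun z => - Ci * f z)%C), limit_of_entire_scal.
Qed.

(** * Means over a horizontal segment of length one *)

Definition mean (f : C -> C) (w : C) : C :=
  (RInt (fun x => Re (f (w + RtoC x)%C)) (-1/2) (1/2),
   RInt (fun x => Im (f (w + RtoC x)%C)) (-1/2) (1/2)).

Lemma mean_ext (f g : C -> C) (w : C) : (forall u, f u = g u) -> mean f w = mean g w.
Proof.
  intros E; apply C_ext; apply RInt_ext; intros; now rewrite E.
Qed.

Lemma mean_plus (f g : C -> C) (w : C) :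
  (forall u, continuous_C f u) -> (forall u, continuous_C g u) ->
  mean (fun u => f u + g u)%C w = (mean f w + mean g w)%C.
Proof.
  intros F G.
  assert (L : forall f : C -> C, (forall u, continuous_C f u) -> forall x : R,
    continuous_C (fun x : R => f (w + RtoC x)%C) x).
  { clear; intros f F x; apply (continuous_C_comp f (fun x : R => (w + RtoC x)%C)); [|apply F].
    apply continuous_C_plus; [apply continuous_C_const|].
    apply (continuous_C_RtoC (U := R_UniformSpace)), continuous_id. }
  apply C_ext; simpl;
    apply (RInt_plus (V := R_CompleteNormedModule)); apply ex_RInt_continuous_all; intros;
    now apply L.
Qed.

Lemma mean_scal (k : C) (f : C -> C) (w : C) :
  (forall u, continuous_C f u) -> mean (fun u => k * f u)%C w = (k * mean f w)%C.
Proof.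
  intros F.
  assert (L : forall x : R, continuous_C (fun x : R => f (w + RtoC x)%C) x).
  { intros x; apply (continuous_C_comp f (fun x : R => (w + RtoC x)%C)); [|apply F].
    apply continuous_C_plus; [apply continuous_C_const|].
    apply (continuous_C_RtoC (U := R_UniformSpace)), continuous_id. }
  assert (L1 : forall a b, ex_RInt (fun x => Re (f (w + RtoC x)%C)) a b)
    by (intros; apply ex_RInt_continuous_all; apply L).
  assert (L2 : forall a b, ex_RInt (fun x => Im (f (w + RtoC x)%C)) a b)
    by (intros; apply ex_RInt_continuous_all; apply L).
  apply C_ext; apply is_RInt_unique.
  - apply (is_RInt_ext (fun x => minus (scal (Re k) (Re (f (w + RtoC x)%C)))
        (scal (Im k) (Im (f (w + RtoC x)%C))))).
    { reflexivity. }
    apply (is_RInt_minus (V := R_NormedModule)); apply (is_RInt_scal (V := R_NormedModule));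
      apply (RInt_correct (V := R_CompleteNormedModule)); auto.
  - apply (is_RInt_ext (fun x => plus (scal (Re k) (Im (f (w + RtoC x)%C)))
        (scal (Im k) (Re (f (w + RtoC x)%C))))).
    { reflexivity. }
    apply (is_RInt_plus (V := R_NormedModule)); apply (is_RInt_scal (V := R_NormedModule));
      apply (RInt_correct (V := R_CompleteNormedModule)); auto.
Qed.

Lemma RInt_close (f g : R -> R) (a b eps : R) :
  a <= b -> (forall x, continuous f x) -> (forall x, continuous g x) ->
  (forall x, a <= x <= b -> Rabs (f x - g x) <= eps) ->
  Rabs (RInt f a b - RInt g a b) <= (b - a) * eps.
Proof.
  intros Hab F G H.
  assert (Ef := ex_RInt_continuous_all f a b F); assert (Eg := ex_RInt_continuous_all g a b G).
  change (RInt f a b - RInt g a b) with (minus (RInt f a b) (RInt g a b)).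
  rewrite <- (RInt_minus (V := R_CompleteNormedModule)) by assumption.
  apply abs_RInt_le_const; auto.
  apply (ex_RInt_minus (V := R_NormedModule)); assumption.
Qed.

(** [contour_shift] applies to the approximants, which need not be periodic. Their boundary term
    involves increments over a unit step, where the limit has increment 0, so these increments
    become arbitrarily small. *)
Lemma RInt_Re_shift (f : C -> C) (w v : C) :
  limit_of_entire f -> (forall u, f (u + 1)%C = f u) ->
  RInt (fun x => Re (f (w + v + RtoC x)%C)) (-1/2) (1/2)
  = RInt (fun x => Re (f (w + RtoC x)%C)) (-1/2) (1/2).
Proof.
  intros Hf Hp; assert (Hc := limit_of_entire_continuous f Hf).
  (* This disc contains the parallelogram of points $w+x+tv$ with $|x|\le 1/2$ and $0\le t\le 1$. *)
  destruct Hf as (F & F1 & F2); destruct (F2 (Cmod w + Cmod v + 1)) as [_ F3].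
  set (A := RInt _ _ _); set (B := RInt _ _ _).
  apply Rminus_diag_uniq.
  assert (Hx : forall x, -1/2 <= x <= 1/2 -> Cmod (RtoC x) <= 1)
    by (intros; rewrite Cmod_R; apply Rabs_le; lra).
  (* One [eps] for each of the two integrals, and [2 * Cmod v * eps] for the boundary term. *)
  assert (K : forall eps, 0 < eps -> Rabs (A - B) <= (2 + 2 * Cmod v) * eps).
  { intros eps He; destruct (F3 eps He) as [N HN].
    specialize (HN N); assert (HN' := fun u => HN u (le_n _)); clear HN.
    destruct (F1 N) as (Fc & _).
    assert (S := contour_shift (F N) w v (-1/2) (1/2) (F1 N)).
    set (A' := RInt _ _ _) in S; set (B' := RInt _ _ _) in S; set (D := RInt _ _ _) in S.
    assert (HA : Rabs (A - A') <= (1/2 - -1/2) * eps).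
    { apply RInt_close; [lra| | |].
      - intros; now apply continuous_Re_line1.
      - intros; now apply continuous_Re_line1.
      - intros x Hx'. rewrite <- Rabs_Ropp.
        eapply Rle_trans; [|apply (HN' (w + v + RtoC x)%C)].
        + eapply Rle_trans; [|apply re_le_Cmod]; unfold Re; simpl; right; f_equal; ring.
        + specialize (Hx x Hx').
          eapply Rle_trans; [apply Cmod_triangle|]; apply Rplus_le_compat; [|lra].
          apply Cmod_triangle. }
    assert (HB : Rabs (B - B') <= (1/2 - -1/2) * eps).
    { apply RInt_close; [lra| | |].
      - intros; now apply continuous_Re_line1.
      - intros; now apply continuous_Re_line1.
      - intros x Hx'. rewrite <- Rabs_Ropp.
        eapply Rle_trans; [|apply (HN' (w + RtoC x)%C)].
        + eapply Rle_trans; [|apply re_le_Cmod]; unfold Re; simpl; right; f_equal; ring.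
        + specialize (Hx x Hx').
          eapply Rle_trans; [apply Cmod_triangle|]; pose proof (Cmod_ge_0 v); lra. }
    assert (HD : Rabs D <= (1 - 0) * (Cmod v * (2 * eps))).
    { apply abs_RInt_le_const; [lra| |].
      - apply ex_RInt_continuous_all; intros t; now apply continuous_Re_increment.
      - intros t Ht; eapply Rle_trans; [apply re_le_Cmod|]; rewrite Cmod_mult.
        apply Rmult_le_compat_l; [apply Cmod_ge_0|].
        set (p := (w + RtoC (1/2) + RtoC t * v)%C); set (m := (w + RtoC (-1/2) + RtoC t * v)%C).
        assert (E : f p = f m).
        { rewrite <- (Hp m); unfold p, m; f_equal; apply C_ext; simpl; field. }
        assert (Bd : forall x, -1/2 <= x <= 1/2 ->
          Cmod (w + RtoC x + RtoC t * v) <= Cmod w + Cmod v + 1).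
        { intros x Hx'; specialize (Hx x Hx').
          eapply Rle_trans; [apply Cmod_triangle|].
          assert (H1 := Cmod_triangle w (RtoC x)).
          assert (H2 : Cmod (RtoC t * v) <= Cmod v).
          { rewrite Cmod_mult, Cmod_R, Rabs_pos_eq by lra.
            pose proof (Cmod_ge_0 v); nra. }
          lra. }
        assert (P1 := HN' p (Bd (1/2) ltac:(lra))).
        assert (P2 := HN' m (Bd (-1/2) ltac:(lra))).
        replace (F N p - F N m)%C with ((F N p - f p) + - (F N m - f m))%C
          by (rewrite E; ring).
        eapply Rle_trans; [apply Cmod_triangle|]; rewrite Cmod_opp; lra. }
    replace (A - B) with ((A - A') - (B - B') + D) by (rewrite <- S; ring).
    eapply Rle_trans; [apply Rabs_triang|].
    assert (T := Rabs_triang (A - A') (- (B - B'))); rewrite Rabs_Ropp in T.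
    unfold Rminus in *; lra. }
  destruct (Req_dec (A - B) 0) as [E|E]; [exact E|exfalso].
  assert (E' := Rabs_pos_lt _ E).
  assert (V := Cmod_ge_0 v).
  specialize (K (Rabs (A - B) / (2 * (2 + 2 * Cmod v)))
    ltac:(apply Rdiv_lt_0_compat; lra)).
  replace ((2 + 2 * Cmod v) * (Rabs (A - B) / (2 * (2 + 2 * Cmod v))))
    with (Rabs (A - B) / 2) in K by (field; lra).
  lra.
Qed.

Lemma mean_shift (f : C -> C) (w v : C) :
  limit_of_entire f -> (forall u, f (u + 1)%C = f u) -> mean f (w + v) = mean f w.
Proof.
  intros Hf Hp; apply C_ext; simpl; [now apply RInt_Re_shift|].
  assert (H := RInt_Re_shift (fun u => - Ci * f u)%C w v (limit_of_entire_scal _ _ Hf)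
    ltac:(intros; simpl; now rewrite Hp)).
  rewrite !(RInt_ext (fun x => Im _) (fun x => Re (- Ci * _)%C) _ _ (fun x _ => Im_Re _)).
  exact H.
Qed.

(** Frequencies are counted in halves: even [k] gives period 1, odd [k] a sign change. The same
    symbol serves for the nome, [expk 2 tau] being $q$, so that all multipliers combine by
    additivity. *)
Definition expk (k : Z) (u : C) : C := Cexp (RtoC (IZR k) * (RtoC PI * Ci * u)).

Lemma expk_plus_arg (k : Z) (u v : C) : expk k (u + v) = (expk k u * expk k v)%C.
Proof. unfold expk; rewrite <- Cexp_plus; f_equal; ring. Qed.

Lemma expk_plus (k l : Z) (u : C) : expk (k + l) u = (expk k u * expk l u)%C.
Proof. unfold expk; rewrite <- Cexp_plus, plus_IZR, RtoC_plus; f_equal; ring. Qed.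

Lemma expk_odd_1 (j : Z) : expk (2 * j + 1) 1 = (-1)%C.
Proof.
  rewrite expk_plus; unfold expk.
  replace (RtoC (IZR (2 * j)) * (RtoC PI * Ci * 1))%C with (RtoC (2 * PI * IZR j) * Ci)%C
    by (rewrite mult_IZR, !RtoC_mult; ring).
  rewrite Cexp_2PI_Z, !Cmult_1_l, Cmult_1_r; apply Cexp_PI.
Qed.

Lemma entire_expk (k : Z) : entire (expk k).
Proof.
  apply entire_Cexp, entire_mult; [apply entire_const|].
  apply entire_mult; [apply entire_const | apply entire_id].
Qed.

(** The kernel $\cos(\pi(u-w))^{2n+1}$ is a finite combination of exponentials of odd frequency, so
    [zero_of_cos_kernel] applies on the segment centred at [w]. *)
Lemma zero_of_odd_coefficients (f : C -> C) (w : C) :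
  (forall u, continuous_C f u) ->
  (forall j, mean (fun u => f u * expk (2 * j + 1) u)%C w = 0) ->
  f w = 0.
Proof.
  intros Hf Hj.
  set (cc := fun u => ((expk 1 (u - w) + expk (-1) (u - w)) * RtoC (/ 2))%C).
  assert (He : forall k (u : C), continuous_C (fun u => expk k (u - w)%C) u).
  { intros k u; apply (continuous_C_comp (expk k) (fun u => (u - w)%C)).
    - apply continuous_C_plus; [apply continuous_C_id | apply continuous_C_const].
    - apply entire_expk. }
  assert (Hcc : forall u : C, continuous_C cc u).
  { intros u; apply continuous_C_mult; [apply continuous_C_plus; apply He|].
    apply continuous_C_const. }
  assert (Hccn : forall n (u : C), continuous_C (fun u => (cc u ^ n)%C) u).
  { induction n; intros u; [apply continuous_C_const|].
    now apply (continuous_C_mult cc (fun u => (cc u ^ n)%C)). }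
  (* The parity of [k + n] is the invariant: expanding one factor [cc] lowers [n] by one and moves
     [k] by one either way, until [n = 0] leaves an odd frequency. *)
  assert (HK : forall n k j, (k + Z.of_nat n = 2 * j + 1)%Z ->
    mean (fun u => f u * (cc u ^ n * expk k (u - w)))%C w = 0).
  { induction n as [|n IH]; intros k j E.
    - rewrite (mean_ext _ (fun u => expk k (- w) * (f u * expk k u))%C).
      + rewrite mean_scal.
        * replace k with (2 * j + 1)%Z by lia; rewrite Hj; ring.
        * intros; apply continuous_C_mult; [apply Hf | apply entire_expk].
      + intros u; unfold Cminus; rewrite expk_plus_arg; simpl; ring.
    - assert (Hc : forall k (u : C),
        continuous_C (fun u => f u * (cc u ^ n * expk k (u - w)))%C u).
      { intros; apply continuous_C_mult; [apply Hf|]; now apply continuous_C_mult. }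
      rewrite (mean_ext _ (fun u => RtoC (/ 2) * (f u * (cc u ^ n * expk (k + 1) (u - w))
        + f u * (cc u ^ n * expk (k + -1) (u - w))))%C).
      + rewrite mean_scal by (intros; apply continuous_C_plus; apply Hc).
        rewrite mean_plus by apply Hc.
        rewrite (IH (k + 1)%Z j), (IH (k + -1)%Z (j - 1)%Z) by lia; ring.
      + intros u; rewrite Cpow_S, !expk_plus; unfold cc at 1; ring. }
  assert (Hcos : forall x : R, cc (w + RtoC x)%C = RtoC (cos (PI * x))).
  { intros x; unfold cc; replace (w + RtoC x - w)%C with (RtoC x) by ring.
    apply C_ext; unfold expk, Cexp, Re, Im; simpl.
    - match goal with |- context [exp ?a * cos ?b + exp ?c * cos ?d] =>
        replace a with 0 by ring; replace c with 0 by ring;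
        replace b with (PI * x) by ring; replace d with (- (PI * x)) by ring end.
      rewrite exp_0, cos_neg, sin_neg; field.
    - match goal with |- context [exp ?a * sin ?b + exp ?c * sin ?d] =>
        replace a with 0 by ring; replace c with 0 by ring;
        replace b with (PI * x) by ring; replace d with (- (PI * x)) by ring end.
      rewrite exp_0, cos_neg, sin_neg; field. }
  assert (Hval : forall n (x : R),
    (f (w + RtoC x) * (cc (w + RtoC x) ^ n * expk 0 (w + RtoC x - w)))%C
    = (f (w + RtoC x) * RtoC (cos (PI * x) ^ n))%C).
  { intros n x; rewrite Hcos; unfold expk; rewrite Cmult_0_l, Cexp_0, RtoC_pow; ring. }
  assert (HL : forall x : R, continuous_C (fun x : R => f (w + RtoC x * 1)%C) x)
    by (intros; now apply continuous_C_line).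
  replace w with (w + RtoC 0)%C by ring.
  apply C_ext.
  - apply (zero_of_cos_kernel (fun x => Re (f (w + RtoC x)%C))).
    + intros; now apply continuous_Re_line1.
    (* Frequency 0 with an odd power of [cc] satisfies the parity condition of [HK]. *)
    + intros n; set (g := fun u => (f u * (cc u ^ (2 * n + 1) * expk 0 (u - w)))%C).
      transitivity (Re (mean g w)); [|unfold g; now rewrite (HK _ _ (Z.of_nat n)) by lia].
      apply RInt_ext; intros x _; unfold g; rewrite Hval, re_scal_r; reflexivity.
  - apply (zero_of_cos_kernel (fun x => Im (f (w + RtoC x)%C))).
    + intros x; apply continuous_ext with (2 := proj2 (HL x)).
      intros; now rewrite Cmult_1_r.
    + intros n; set (g := fun u => (f u * (cc u ^ (2 * n + 1) * expk 0 (u - w)))%C).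
      transitivity (Im (mean g w)); [|unfold g; now rewrite (HK _ _ (Z.of_nat n)) by lia].
      apply RInt_ext; intros x _; unfold g; rewrite Hval, im_scal_r; reflexivity.
Qed.

Lemma mean_translate (f : C -> C) (w v : C) :
  mean f (w + v) = mean (fun u => f (u + v)%C) w.
Proof.
  apply C_ext; apply RInt_ext; intros; do 2 f_equal; ring.
Qed.

(** These are the multipliers of $\theta_1$ for the lattice generated by 1 and [tau]. *)
Definition theta_like (tau : C) (G : C -> C) : Prop :=
  limit_of_entire G /\
  (forall u, G (u + 1)%C = (- G u)%C) /\
  (forall u, G (u + tau)%C = (- (expk (-1) (tau + (u + u)) * G u))%C).

(* Translating by [tau] multiplies the [j]-th Fourier coefficient into the [(j-1)]-st,
   so a single vanishing coefficient kills them all. *)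
Lemma theta_like_zero (tau : C) (G : C -> C) :
  theta_like tau G -> mean (fun u => G u * expk 1 u)%C 0 = 0 -> forall u, G u = 0.
Proof.
  intros (HG & H1 & Ht) H0.
  assert (HH : forall j, limit_of_entire (fun u => G u * expk (2 * j + 1) u)%C).
  { intros; apply limit_of_entire_mult; [assumption|].
    apply limit_of_entire_entire, entire_expk. }
  (* [G] and the odd exponential both change sign under $u\mapsto u+1$, so their product has period
     1 and [mean_shift] applies. *)
  assert (HS : forall j w, mean (fun u => G u * expk (2 * j + 1) u)%C w
    = mean (fun u => G u * expk (2 * j + 1) u)%C 0).
  { intros j w; rewrite <- (Cplus_0_l w) at 1; apply mean_shift; [apply HH|].
    intros u; rewrite H1, expk_plus_arg, expk_odd_1; ring. }
  assert (Rec : forall j, mean (fun u => G u * expk (2 * Z.succ j + 1) u)%C 0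
    = (- (expk (2 * Z.succ j) tau) * mean (fun u => G u * expk (2 * j + 1) u)%C 0)%C).
  { intros j; rewrite <- (HS _ tau), <- mean_scal
      by (apply limit_of_entire_continuous, HH).
    rewrite <- (Cplus_0_l tau) at 1; rewrite mean_translate; apply mean_ext; intros u.
    rewrite Ht.
    assert (E : (expk (-1) (tau + (u + u)) * expk (2 * Z.succ j + 1) (u + tau)
      = expk (2 * Z.succ j) tau * expk (2 * j + 1) u)%C).
    { unfold expk; rewrite <- !Cexp_plus, !plus_IZR, !mult_IZR, succ_IZR.
      f_equal; apply C_ext; simpl; ring. }
    transitivity (- (G u * (expk (-1) (tau + (u + u)) * expk (2 * Z.succ j + 1) (u + tau))))%C;
      [|rewrite E]; ring. }
  (* The factor in the recurrence is invertible, so vanishing spreads to larger and to smaller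
     [j]. *)
  assert (All : forall j, mean (fun u => G u * expk (2 * j + 1) u)%C 0 = 0).
  { apply Z.bi_induction.
    - intros ? ? ->; reflexivity.
    - exact H0.
    - intros j; rewrite Rec; split; intros E.
      + rewrite E; ring.
      + replace (mean (fun u => G u * expk (2 * j + 1) u)%C 0) with
          (/ - expk (2 * Z.succ j) tau * (- expk (2 * Z.succ j) tau *
            mean (fun u => G u * expk (2 * j + 1) u)%C 0))%C.
        * rewrite E; ring.
        * assert (N : expk (2 * Z.succ j) tau <> 0) by apply Cexp_neq_0.
          field; intros E'; apply N.
          replace (expk _ _) with (- - expk (2 * Z.succ j) tau)%C by ring.
          rewrite E'; ring. }
  intros u; apply zero_of_odd_coefficients; [now apply limit_of_entire_continuous|].
  intros j; now rewrite HS.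
Qed.

(** Subtracting the multiple of [G1] with the same mean against [expk 1] leaves a function that
    [theta_like_zero] kills; by the same lemma this mean is nonzero for [G1]. *)
Lemma theta_like_proportional (tau : C) (G1 G2 : C -> C) :
  theta_like tau G1 -> theta_like tau G2 -> (exists u, G1 u <> 0) ->
  exists k, forall u, G2 u = (k * G1 u)%C.
Proof.
  intros T1 T2 [u0 H0].
  set (c := fun G : C -> C => mean (fun u => G u * expk 1 u)%C 0).
  assert (N : c G1 <> 0).
  { intros E; apply H0; now apply (theta_like_zero tau). }
  exists (c G2 / c G1)%C.
  assert (D : forall u, (G2 u + - (c G2 / c G1) * G1 u)%C = 0).
  { apply (theta_like_zero tau (fun u => G2 u + - (c G2 / c G1) * G1 u)%C).
    - destruct T1 as (A1 & A2 & A3), T2 as (B1 & B2 & B3); split; [|split].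
      + apply limit_of_entire_plus; [assumption | now apply limit_of_entire_scal].
      + intros; rewrite A2, B2; ring.
      + intros; rewrite A3, B3; ring.
    - assert (L : forall G, theta_like tau G -> forall u : C,
        continuous_C (fun u => G u * expk 1 u)%C u).
      { intros G [HG _] u; apply continuous_C_mult;
          [now apply limit_of_entire_continuous | apply entire_expk]. }
      rewrite (mean_ext _ (fun u => G2 u * expk 1 u
        + (- (c G2 / c G1)) * (G1 u * expk 1 u))%C) by (intros; ring).
      rewrite mean_plus, mean_scal.
      + fold (c G1) (c G2); field; assumption.
      + now apply L.
      + now apply L.
      + intros; apply continuous_C_mult; [apply continuous_C_const | now apply L]. }
  intros u; specialize (D u).
  replace (G2 u) with ((G2 u + - (c G2 / c G1) * G1 u) + c G2 / c G1 * G1 u)%C by ring.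
  rewrite D; ring.
Qed.

(** * Infinite products *)

(** [Clim] returns a value even for a divergent sequence; this predicate records convergence. *)
Definition is_Clim (u : nat -> C) (l : C) : Prop :=
  forall eps, 0 < eps -> exists N, forall n, (N <= n)%nat -> Cmod (u n - l) < eps.

Lemma is_Clim_Clim (u : nat -> C) (l : C) : is_Clim u l -> Clim u = l.
Proof.
  intros H; unfold Clim.
  assert (R1 : is_lim_seq (fun n => Re (u n)) (Re l)).
  { apply is_lim_seq_spec; intros [eps He]; destruct (H eps He) as [N HN].
    exists N; intros n Hn; eapply Rle_lt_trans; [apply (re_le_Cmod (u n - l)) | auto]. }
  assert (R2 : is_lim_seq (fun n => Im (u n)) (Im l)).
  { apply is_lim_seq_spec; intros [eps He]; destruct (H eps He) as [N HN].
    exists N; intros n Hn; eapply Rle_lt_trans; [apply (im_le_Cmod (u n - l)) | auto]. }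
  rewrite (is_lim_seq_unique _ _ R1), (is_lim_seq_unique _ _ R2); now destruct l.
Qed.

Lemma is_Clim_unique (u : nat -> C) (l l' : C) : is_Clim u l -> is_Clim u l' -> l = l'.
Proof. intros H H'; now rewrite <- (is_Clim_Clim _ _ H), <- (is_Clim_Clim _ _ H'). Qed.

Lemma is_Clim_ext (u v : nat -> C) (l : C) :
  (forall n, u n = v n) -> is_Clim u l -> is_Clim v l.
Proof.
  intros E H eps He; destruct (H eps He) as [N HN]; exists N; intros; rewrite <- E; auto.
Qed.

Lemma is_Clim_const (k : C) : is_Clim (fun _ => k) k.
Proof.
  intros eps He; exists O; intros; replace (k - k)%C with (RtoC 0) by ring.
  now rewrite Cmod_0.
Qed.

Lemma is_Clim_S (u : nat -> C) (l : C) : is_Clim u l -> is_Clim (fun n => u (S n)) l.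
Proof.
  intros H eps He; destruct (H eps He) as [N HN]; exists N; intros; apply HN; lia.
Qed.

Lemma is_Clim_mult (u v : nat -> C) (l m : C) :
  is_Clim u l -> is_Clim v m -> is_Clim (fun n => u n * v n)%C (l * m)%C.
Proof.
  intros H H' eps He.
  destruct (H 1 Rlt_0_1) as [N0 HN0].
  set (L := Cmod l + Cmod m + 1).
  assert (L0 := Cmod_ge_0 l); assert (M0 := Cmod_ge_0 m).
  assert (He' : 0 < eps / (2 * L)) by (apply Rdiv_lt_0_compat; unfold L; lra).
  destruct (H _ He') as [N1 HN1], (H' _ He') as [N2 HN2].
  exists (N0 + N1 + N2)%nat; intros n Hn.
  specialize (HN0 n ltac:(lia)); specialize (HN1 n ltac:(lia)); specialize (HN2 n ltac:(lia)).
  replace (u n * v n - l * m)%C with (u n * (v n - m) + (u n - l) * m)%C by ring.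
  eapply Rle_lt_trans; [apply Cmod_triangle|]; rewrite !Cmod_mult.
  assert (B : Cmod (u n) <= L).
  { replace (u n) with ((u n - l) + l)%C by ring.
    eapply Rle_trans; [apply Cmod_triangle|]; unfold L; lra. }
  assert (B' : Cmod m <= L) by (unfold L; lra).
  replace eps with (L * (eps / (2 * L)) + eps / (2 * L) * L) by (field; unfold L; lra).
  apply Rplus_lt_le_compat.
  - apply Rle_lt_trans with (L * Cmod (v n - m)).
    + apply Rmult_le_compat_r; [apply Cmod_ge_0 | assumption].
    + apply Rmult_lt_compat_l; [unfold L; lra | assumption].
  - apply Rmult_le_compat; try apply Cmod_ge_0; lra.
Qed.

Lemma Cprod1_ext (f g : nat -> C) (n : nat) :
  (forall m, (1 <= m)%nat -> f m = g m) -> Cprod1 f n = Cprod1 g n.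
Proof. intros E; induction n; simpl; [reflexivity|]; rewrite IHn, E; [reflexivity|lia]. Qed.

Lemma Cprod1_mult (f g : nat -> C) (n : nat) :
  Cprod1 (fun m => f m * g m)%C n = (Cprod1 f n * Cprod1 g n)%C.
Proof. induction n; simpl; [|rewrite IHn]; ring. Qed.

Lemma Cprod1_1 (n : nat) : Cprod1 (fun _ => RtoC 1) n = 1.
Proof. induction n; simpl; [reflexivity|]; rewrite IHn; ring. Qed.

Lemma Cprod1_S_l (f : nat -> C) (n : nat) :
  Cprod1 f (S n) = (f 1%nat * Cprod1 (fun m => f (S m)) n)%C.
Proof.
  induction n; [simpl; ring|].
  change (Cprod1 f (S (S n))) with (Cprod1 f (S n) * f (S (S n)))%C.
  rewrite IHn; simpl; ring.
Qed.

Section GeometricProduct.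

Variables (f : nat -> C) (c r : R).
Hypotheses (c0 : 0 <= c) (r0 : 0 <= r) (r1 : r < 1).
Hypothesis Hf : forall m, Cmod (f m - 1) <= c * r ^ m.

(** The bound depends on [f] only through [c] and [r], which later makes it uniform in [u] on
    discs. *)
Lemma Cmod_Cprod1_le (n : nat) : Cmod (Cprod1 f n) <= exp (c / (1 - r)).
Proof.
  (* The induction carries the partial geometric sum $r+\dots+r^n$ in the exponent; each new factor
     is absorbed by $1+x\le e^x$. *)
  assert (H : Cmod (Cprod1 f n) <= exp (c * ((r - r ^ S n) / (1 - r)))).
  { induction n as [|n IH].
    - simpl; rewrite Cmod_1; replace (c * ((r - r * 1) / (1 - r))) with 0 by (field; lra).
      rewrite exp_0; lra.
    - change (Cprod1 f (S n)) with (Cprod1 f n * f (S n))%C; rewrite Cmod_mult.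
      replace (c * ((r - r ^ S (S n)) / (1 - r)))
        with (c * ((r - r ^ S n) / (1 - r)) + c * r ^ S n) by (simpl; field; lra).
      rewrite exp_plus; apply Rmult_le_compat; try apply Cmod_ge_0; [exact IH|].
      eapply Rle_trans; [|apply exp_ineq1_le].
      replace (f (S n)) with (1 + (f (S n) - 1))%C by ring.
      eapply Rle_trans; [apply Cmod_triangle|]; rewrite Cmod_1.
      apply Rplus_le_compat_l, Hf. }
  eapply Rle_trans; [exact H|].
  assert (E : c * ((r - r ^ S n) / (1 - r)) <= c / (1 - r)).
  { unfold Rdiv; rewrite <- Rmult_assoc; apply Rmult_le_compat_r.
    - apply Rlt_le, Rinv_0_lt_compat; lra.
    - assert (0 <= r ^ S n) by now apply pow_le. nra. }
  destruct E as [E|E]; [apply Rlt_le, exp_increasing, E | rewrite E; lra].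
Qed.

(** The exponential bounds the partial products, and $c\,r^n/(1-r)$ bounds the tail
    $\sum_{m>n}c\,r^m$. *)
Definition Cprod1_rate : R := exp (c / (1 - r)) * c / (1 - r).

Lemma Cprod1_rate_ge0 : 0 <= Cprod1_rate.
Proof.
  apply Rdiv_le_0_compat; [|lra].
  apply Rmult_le_pos; [apply Rlt_le, exp_pos | assumption].
Qed.

Lemma Cprod1_cauchy (n k : nat) :
  Cmod (Cprod1 f (n + k) - Cprod1 f n) <= Cprod1_rate * r ^ n.
Proof.
  assert (H : Cmod (Cprod1 f (n + k) - Cprod1 f n)
              <= exp (c / (1 - r)) * (c * (r ^ S n * (1 - r ^ k) / (1 - r)))).
  { induction k as [|k IH].
    - rewrite Nat.add_0_r; replace (Cprod1 f n - Cprod1 f n)%C with (RtoC 0) by ring.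
      rewrite Cmod_0; simpl; right; field; lra.
    - rewrite Nat.add_succ_r.
      change (Cprod1 f (S (n + k))) with (Cprod1 f (n + k) * f (S (n + k)))%C.
      replace (_ - _)%C with ((Cprod1 f (n + k) - Cprod1 f n)
        + Cprod1 f (n + k) * (f (S (n + k)) - 1))%C by ring.
      eapply Rle_trans; [apply Cmod_triangle|]; rewrite Cmod_mult.
      replace (exp (c / (1 - r)) * (c * (r ^ S n * (1 - r ^ S k) / (1 - r)))) with
        (exp (c / (1 - r)) * (c * (r ^ S n * (1 - r ^ k) / (1 - r)))
         + exp (c / (1 - r)) * (c * r ^ S (n + k))).
      + apply Rplus_le_compat; [exact IH|].
        apply Rmult_le_compat; try apply Cmod_ge_0; [apply Cmod_Cprod1_le | apply Hf].
      + replace (r ^ S (n + k)) with (r ^ S n * r ^ k) by (rewrite <- pow_add; f_equal; lia).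
        simpl; field; lra. }
  eapply Rle_trans; [exact H|]; unfold Cprod1_rate.
  replace (exp (c / (1 - r)) * c / (1 - r) * r ^ n) with
    (exp (c / (1 - r)) * (c * (r ^ n / (1 - r)))) by (field; lra).
  apply Rmult_le_compat_l; [apply Rlt_le, exp_pos|].
  apply Rmult_le_compat_l; [assumption|].
  apply Rmult_le_compat_r; [apply Rlt_le, Rinv_0_lt_compat; lra|].
  assert (0 <= r ^ n) by now apply pow_le.
  assert (0 <= r ^ k) by now apply pow_le.
  assert (r * (1 - r ^ k) <= 1) by nra.
  simpl; nra.
Qed.

Lemma pow_small (eps k : R) :
  0 < eps -> 0 <= k -> exists N, forall n, (N <= n)%nat -> k * r ^ n < eps.
Proof.
  intros He Hk.
  assert (L : is_lim_seq (fun n => k * r ^ n) 0).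
  { replace (Finite 0) with (Rbar_mult k 0) by (simpl; now rewrite Rmult_0_r).
    apply is_lim_seq_scal_l, is_lim_seq_geom; rewrite Rabs_pos_eq; lra. }
  apply is_lim_seq_spec in L; destruct (L (mkposreal _ He)) as [N HN]; exists N; intros n Hn.
  specialize (HN n Hn); simpl in HN; rewrite Rminus_0_r in HN.
  eapply Rle_lt_trans; [apply Rle_abs | exact HN].
Qed.

Lemma Cprod1_Cinfprod (n : nat) :
  Cmod (Cprod1 f n - Cinfprod f) <= 2 * Cprod1_rate * r ^ n.
Proof.
  (* [Cinfprod] takes the limits of real and imaginary parts separately; [g] stands for either, and
     adding the two estimates gives the factor 2. *)
  assert (H : forall g : C -> R, (forall u v, Rabs (g u - g v) <= Cmod (u - v)) ->
    Rabs (g (Cprod1 f n) - real (Lim_seq (fun k => g (Cprod1 f k)))) <= Cprod1_rate * r ^ n).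
  { intros g Hg.
    assert (Ex : ex_finite_lim_seq (fun k => g (Cprod1 f k))).
    { apply ex_lim_seq_cauchy_corr; intros [eps He]; simpl.
      destruct (pow_small eps (2 * Cprod1_rate) He) as [N HN];
        [pose proof Cprod1_rate_ge0; lra|].
      exists N; intros a b Ha Hb.
      specialize (HN N (le_n _)).
      replace a with (N + (a - N))%nat by lia; replace b with (N + (b - N))%nat by lia.
      assert (A := Rle_trans _ _ _ (Hg _ _) (Cprod1_cauchy N (a - N))).
      assert (B := Rle_trans _ _ _ (Hg _ _) (Cprod1_cauchy N (b - N))).
      apply Rabs_le_between in A; apply Rabs_le_between in B; apply Rabs_def1; lra. }
    destruct Ex as [l Hl]; rewrite (is_lim_seq_unique _ _ Hl); simpl.
    assert (L : is_lim_seq (fun k => Rabs (g (Cprod1 f n) - g (Cprod1 f (k + n)%nat)))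
                  (Rabs (g (Cprod1 f n) - l))).
    { apply (is_lim_seq_abs _ (g (Cprod1 f n) - l)).
      apply (is_lim_seq_minus' _ _ (g (Cprod1 f n)) l); [apply is_lim_seq_const|].
      apply (is_lim_seq_incr_n (fun k => g (Cprod1 f k)) n), Hl. }
    apply (is_lim_seq_le _ (fun _ => Cprod1_rate * r ^ n) _ _) with (2 := L)
      (3 := is_lim_seq_const _).
    intros k; rewrite Rabs_minus_sym; eapply Rle_trans; [apply Hg|].
    rewrite Nat.add_comm; apply Cprod1_cauchy. }
  eapply Rle_trans; [apply Cmod_le_re_im|].
  assert (A := H Re (fun u v => re_le_Cmod (u - v))).
  assert (B := H Im (fun u v => im_le_Cmod (u - v))).
  change (Re (Cprod1 f n - Cinfprod f)) with
    (Re (Cprod1 f n) - real (Lim_seq (fun k => Re (Cprod1 f k)))).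
  change (Im (Cprod1 f n - Cinfprod f)) with
    (Im (Cprod1 f n) - real (Lim_seq (fun k => Im (Cprod1 f k)))).
  lra.
Qed.

Lemma is_Clim_Cprod1 : is_Clim (Cprod1 f) (Cinfprod f).
Proof.
  intros eps He.
  destruct (pow_small eps (2 * Cprod1_rate) He) as [N HN];
    [pose proof Cprod1_rate_ge0; lra|].
  exists N; intros n Hn; eapply Rle_lt_trans; [apply Cprod1_Cinfprod | auto].
Qed.

End GeometricProduct.

(* The infinite q-Pochhammer symbol [(x q; q)_oo]. *)
Definition qpoch (q x : C) : C := Cinfprod (fun m => 1 - x * q ^ m)%C.

Lemma qpoch_factor_bound (q x : C) (c : R) (m : nat) :
  Cmod x <= c -> Cmod (1 - x * q ^ m - 1) <= c * Cmod q ^ m.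
Proof.
  intros Hx; replace (1 - x * q ^ m - 1)%C with (- (x * q ^ m))%C by ring.
  rewrite Cmod_opp, Cmod_mult, Cmod_pow.
  apply Rmult_le_compat_r; [apply pow_le, Cmod_ge_0 | assumption].
Qed.

Lemma is_Clim_qpoch (q x : C) :
  Cmod q < 1 -> is_Clim (Cprod1 (fun m => 1 - x * q ^ m)%C) (qpoch q x).
Proof.
  intros Hq; apply is_Clim_Cprod1 with (c := Cmod x) (r := Cmod q);
    try apply Cmod_ge_0; [assumption|].
  intros m; apply qpoch_factor_bound; lra.
Qed.

Lemma qpoch_shift (q x : C) :
  Cmod q < 1 -> qpoch q x = ((1 - x * q) * qpoch q (x * q))%C.
Proof.
  intros Hq; apply is_Clim_unique with (fun n => Cprod1 (fun m => 1 - x * q ^ m)%C (S n)).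
  - now apply (is_Clim_S (Cprod1 (fun m => 1 - x * q ^ m)%C)), is_Clim_qpoch.
  - apply is_Clim_ext with (fun n => (1 - x * q) * Cprod1 (fun m => 1 - (x * q) * q ^ m)%C n)%C.
    + intros n; rewrite Cprod1_S_l, Cpow_1_r; f_equal.
      apply Cprod1_ext; intros; rewrite Cpow_S; ring.
    + apply is_Clim_mult; [apply is_Clim_const | now apply is_Clim_qpoch].
Qed.

(* The inverse factors have a convergent product too. *)
Lemma qpoch_1_neq_0 (q : C) : Cmod q < 1 -> qpoch q 1 <> 0.
Proof.
  intros Hq.
  (* At index 0 the factor $1-q^0$ vanishes; the value 1 is put there because the geometric bound is
     asked at every index, while the products begin at index 1. *)
  set (g := fun m => match m with O => RtoC 1 | S _ => (/ (1 - 1 * q ^ m))%C end).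
  assert (r0 := Cmod_ge_0 q).
  assert (Hm : forall m, 1 - Cmod q <= Cmod (1 - 1 * q ^ S m)).
  { intros m.
    assert (T := Cmod_triangle (1 - 1 * q ^ S m) (1 * q ^ S m)).
    replace (1 - 1 * q ^ S m + 1 * q ^ S m)%C with (RtoC 1) in T by ring.
    rewrite Cmod_1, Cmult_1_l, Cmod_pow in T.
    assert (Cmod q ^ S m <= Cmod q).
    { assert (0 <= Cmod q ^ m <= 1)
        by (split; [now apply pow_le | rewrite <- (pow1 m); apply pow_incr; lra]).
      simpl; nra. }
    rewrite Cmult_1_l; lra. }
  assert (Hn : forall m, (1 - 1 * q ^ S m)%C <> 0).
  { intros m; apply Cmod_gt_0; specialize (Hm m); lra. }
  assert (Hg : is_Clim (Cprod1 g) (Cinfprod g)).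
  { apply is_Clim_Cprod1 with (c := / (1 - Cmod q)) (r := Cmod q); try assumption.
    - apply Rlt_le, Rinv_0_lt_compat; lra.
    - intros [|m]; simpl g.
      + replace (1 - 1)%C with (RtoC 0) by ring; rewrite Cmod_0.
        apply Rmult_le_pos; [apply Rlt_le, Rinv_0_lt_compat|]; simpl; lra.
      + change (q * q ^ m)%C with (q ^ S m)%C.
        replace (/ (1 - 1 * q ^ S m) - 1)%C with (/ (1 - 1 * q ^ S m) * q ^ S m)%C
          by (field; specialize (Hn m); now rewrite Cmult_1_l in Hn).
        rewrite Cmod_mult, Cmod_inv, Cmod_pow by apply Hn.
        apply Rmult_le_compat_r; [now apply pow_le|].
        apply Rinv_le_contravar; [lra | apply Hm]. }
  assert (P := is_Clim_mult _ _ _ _ (is_Clim_qpoch q 1 Hq) Hg).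
  assert (E : is_Clim (fun n => Cprod1 (fun m => 1 - 1 * q ^ m)%C n * Cprod1 g n)%C 1).
  { apply is_Clim_ext with (fun _ => RtoC 1); [|apply is_Clim_const].
    intros n; rewrite <- Cprod1_mult; transitivity (Cprod1 (fun _ => RtoC 1) n);
      [symmetry; apply Cprod1_1 | apply Cprod1_ext].
    intros [|m] Hm'; [lia|]; symmetry; exact (Cinv_r _ (Hn m)). }
  intros E0; rewrite E0, Cmult_0_l in P.
  apply C1_nz; exact (is_Clim_unique _ _ _ E P).
Qed.

Lemma limit_of_entire_qpoch (q : C) (g : C -> C) :
  Cmod q < 1 -> entire g -> limit_of_entire (fun u => qpoch q (g u)).
Proof.
  intros Hq Hg; exists (fun n u => Cprod1 (fun m => 1 - g u * q ^ m)%C n); split.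
  - induction n as [|n IH]; [exact (entire_const 1)|].
    apply (entire_mult (fun u => Cprod1 (fun m => 1 - g u * q ^ m)%C n)); [exact IH|].
    apply entire_ext with (fun u => 1 + (- q ^ S n) * g u)%C; [intros; simpl; ring|].
    apply entire_plus; [apply entire_const|].
    apply entire_mult; [apply entire_const | assumption].
  - intros rho; destruct Hg as (_ & Hb & _); destruct (Hb rho) as [M HM].
    (* The absolute value makes [c] nonnegative even for negative [rho], where [M] is arbitrary. *)
    set (c := Rabs M).
    assert (Hc : forall u, Cmod u <= rho -> Cmod (g u) <= c)
      by (intros u Hu; eapply Rle_trans; [apply HM, Hu | apply Rle_abs]).
    assert (c0 : 0 <= c) by apply Rabs_pos.
    assert (r0 := Cmod_ge_0 q).
    split.
    + exists (exp (c / (1 - Cmod q))); intros n u Hu.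
      apply Cmod_Cprod1_le; auto; intros m; apply qpoch_factor_bound; auto.
    + intros eps He.
      destruct (pow_small (Cmod q) r0 Hq eps (2 * Cprod1_rate c (Cmod q)) He) as [N HN].
      { pose proof (Cprod1_rate_ge0 c (Cmod q) c0 Hq); lra. }
      exists N; intros n u Hn Hu; eapply Rle_trans; [|apply Rlt_le, (HN n Hn)].
      apply Cprod1_Cinfprod; auto; intros m; apply qpoch_factor_bound; auto.
Qed.

(** * The theta function *)

Lemma expk_neq_0 (k : Z) (u : C) : expk k u <> 0.
Proof. apply Cexp_neq_0. Qed.

Lemma expk_0_arg (k : Z) : expk k 0 = 1.
Proof. unfold expk; rewrite !Cmult_0_r; apply Cexp_0. Qed.

Lemma expk_opp (k : Z) (u : C) : expk (- k) u = (/ expk k u)%C.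
Proof. unfold expk; rewrite <- Cexp_opp, opp_IZR, RtoC_opp; f_equal; ring. Qed.

Lemma expk_opp_arg (k : Z) (u : C) : expk k (- u) = (/ expk k u)%C.
Proof. unfold expk; rewrite <- Cexp_opp; f_equal; ring. Qed.

Lemma expk_even_Z (k m : Z) : expk (2 * k) (RtoC (IZR m)) = 1.
Proof.
  unfold expk; rewrite <- (Cexp_2PI_Z (k * m)); f_equal.
  rewrite !mult_IZR, !RtoC_mult; ring.
Qed.

Lemma Cmod_nome (tau : C) : 0 < Im tau -> Cmod (expk 2 tau) < 1.
Proof.
  intros H; unfold expk; rewrite Cmod_Cexp, <- exp_0; apply exp_increasing.
  assert (P := PI_RGT_0); unfold Re, Im in *; simpl; nra.
Qed.

(* Up to the factor [i] and a power of the nome, [phi tau u] is the Jacobi theta function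
   [theta_1 (u | tau)] divided by [qpoch q 1]. *)
Definition phi (tau u : C) : C :=
  ((expk 1 u - expk (-1) u)
   * (qpoch (expk 2 tau) (expk 2 u) * qpoch (expk 2 tau) (expk (-2) u)))%C.

(** This is $\prod_{n\ge1}(1-q^n)^2$, that is [eta] squared without $q^{1/12}$, and also the value
    at [u = 0] of the two Pochhammer factors of [phi]. *)
Definition qpoch_sq (tau : C) : C := (qpoch (expk 2 tau) 1 * qpoch (expk 2 tau) 1)%C.

Lemma qpoch_sq_neq_0 (tau : C) : 0 < Im tau -> qpoch_sq tau <> 0.
Proof. intros H; apply Cmult_neq_0; now apply qpoch_1_neq_0, Cmod_nome. Qed.

Lemma phi_opp (tau u : C) : phi tau (- u) = (- phi tau u)%C.
Proof.
  assert (E : forall k, expk k (- u) = expk (- k) u)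
    by (intros; now rewrite expk_opp, expk_opp_arg).
  unfold phi; rewrite !E; simpl; ring.
Qed.

Lemma phi_add_1 (tau u : C) : phi tau (u + 1) = (- phi tau u)%C.
Proof.
  unfold phi; rewrite !expk_plus_arg.
  rewrite (expk_even_Z 1 1 : expk 2 1 = 1), (expk_even_Z (-1) 1 : expk (-2) 1 = 1),
    (expk_odd_1 0 : expk 1 1 = _), (expk_odd_1 (-1) : expk (-1) 1 = _), !Cmult_1_r.
  ring.
Qed.

(** The translation multiplies $e^{2\pi iu}$ by $q$: one symbol loses the factor $1-e^{2\pi iu}q$,
    the other gains $1-e^{-2\pi iu}$, and together with the change of the prefactor these give the
    multiplier. *)
Lemma phi_add_tau (tau u : C) :
  0 < Im tau -> phi tau (u + tau) = (- (expk (-1) (tau + (u + u)) * phi tau u))%C.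
Proof.
  intros Ht; assert (Hq := Cmod_nome _ Ht).
  unfold phi; rewrite !expk_plus_arg.
  rewrite (qpoch_shift _ (expk 2 u)) by assumption.
  rewrite (qpoch_shift _ (expk (-2) u * expk (-2) tau)%C) by assumption.
  change (-2)%Z with (- (2))%Z; change (-1)%Z with (- (1))%Z; rewrite !expk_opp.
  assert (S0 := expk_neq_0 1 u); assert (Y0 := expk_neq_0 1 tau).
  change 2%Z with (1 + 1)%Z; rewrite !expk_plus.
  set (s := expk 1 u) in *; set (y := expk 1 tau) in *.
  replace (/ (s * s) * / (y * y) * (y * y))%C with (/ (s * s))%C by (field; auto).
  set (A := qpoch _ _); set (B := qpoch _ _); field; auto.
Qed.

Lemma entire_expk_linear (k : Z) (a : C) : entire (fun u => expk k (a * u)).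
Proof.
  apply entire_Cexp, entire_mult; [apply entire_const|].
  apply entire_mult; [apply entire_const|].
  apply entire_mult; [apply entire_const | apply entire_id].
Qed.

Lemma limit_of_entire_qpoch_expk (q a : C) (k : Z) :
  Cmod q < 1 -> limit_of_entire (fun u => qpoch q (expk k (a * u))).
Proof.
  intros Hq; apply limit_of_entire_qpoch; [assumption | apply entire_expk_linear].
Qed.

Lemma limit_of_entire_phi (tau a : C) :
  0 < Im tau -> limit_of_entire (fun u => phi tau (a * u)).
Proof.
  intros Ht; apply Cmod_nome in Ht; apply limit_of_entire_mult.
  - apply limit_of_entire_entire.
    apply entire_ext with (fun u => expk 1 (a * u) + (-1) * expk (-1) (a * u))%C;
      [intros; ring|].
    apply entire_plus; [|apply entire_mult; [apply entire_const|]];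
      apply entire_expk_linear.
  - now apply limit_of_entire_mult; apply limit_of_entire_qpoch_expk.
Qed.

Lemma theta_like_phi (tau : C) : 0 < Im tau -> theta_like tau (phi tau).
Proof.
  intros Ht; split; [|split].
  (* The available statement concerns [1 * u]; its approximation bounds are transferred pointwise to
     [u]. *)
  - destruct (limit_of_entire_phi tau 1 Ht) as (F & F1 & F2); exists F; split; [assumption|].
    intros rho; destruct (F2 rho) as [F3 F4]; split; [assumption|].
    intros eps He; destruct (F4 eps He) as [N HN]; exists N; intros n u Hn Hu.
    rewrite <- (Cmult_1_l u) at 2; auto.
  - intros; apply phi_add_1.
  - intros; now apply phi_add_tau.
Qed.

Lemma neq_0_of_Im (tau : C) : 0 < Im tau -> tau <> 0.
Proof. intros H E; rewrite E in H; simpl in H; lra. Qed.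

Lemma Im_opp_inv (tau : C) : 0 < Im tau -> 0 < Im (- / tau)%C.
Proof.
  intros H; unfold Im in *; simpl.
  replace (- (- snd tau / (fst tau * (fst tau * 1) + snd tau * (snd tau * 1))))
    with (snd tau / (fst tau ^ 2 + snd tau ^ 2)) by (field; nra).
  apply Rdiv_lt_0_compat; nra.
Qed.

Lemma entire_expk_sq (k : Z) (a : C) : entire (fun u => expk k (a * (u * u))).
Proof.
  apply entire_Cexp, entire_mult; [apply entire_const|].
  apply entire_mult; [apply entire_const|].
  apply entire_mult; [apply entire_const|].
  apply entire_mult; apply entire_id.
Qed.

(** Division by [tau] exchanges the periods: the step 1 becomes $1/\tau$, opposite to the period
    $-1/\tau$, and the step [tau] becomes 1. The Gaussian factor reduces the first multiplier to a
    sign and, through $(u+\tau)^2/\tau=u^2/\tau+\tau+2u$, creates the second. *)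
Lemma theta_like_phi_inv (tau : C) :
  0 < Im tau ->
  theta_like tau (fun u => phi (- / tau) (/ tau * u) * expk (-1) (/ tau * (u * u)))%C.
Proof.
  intros Ht; assert (Hs := Im_opp_inv _ Ht); assert (N := neq_0_of_Im _ Ht).
  split; [|split].
  - apply limit_of_entire_mult; [now apply limit_of_entire_phi|].
    apply limit_of_entire_entire, entire_expk_sq.
  - intros u; set (s := (- / tau)%C) in *.
    (* Starting at $(u+1)/\tau$, the translation by $s=-1/\tau$ ends at $u/\tau$. *)
    assert (E := phi_add_tau s (/ tau * (u + 1)) Hs).
    replace (/ tau * (u + 1) + s)%C with (/ tau * u)%C in E by (unfold s; ring).
    rewrite E.
    replace (/ tau * (u * u))%C
      with (/ tau * ((u + 1) * (u + 1)) + - (s + (/ tau * (u + 1) + / tau * (u + 1))))%C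
      by (unfold s; field; assumption).
    rewrite (expk_plus_arg _ (/ tau * ((u + 1) * (u + 1)))), expk_opp_arg.
    field; apply expk_neq_0.
  - intros u.
    replace (/ tau * (u + tau))%C with (/ tau * u + 1)%C by (field; assumption).
    rewrite phi_add_1.
    replace (/ tau * ((u + tau) * (u + tau)))%C
      with (/ tau * (u * u) + (tau + (u + u)))%C by (field; assumption).
    rewrite expk_plus_arg; ring.
Qed.

(** * Slopes at the origin, along the sequence $1/(n+1)$ *)

Definition inv_nat (n : nat) : R := / INR (S n).

Lemma inv_nat_small (d : R) : 0 < d -> exists N, forall n, (N <= n)%nat -> 0 < inv_nat n < d.
Proof.
  intros Hd; destruct (archimed_cor1 d Hd) as (N & HN & N0); exists N; intros n Hn.
  assert (0 < INR (S n)) by (apply lt_0_INR; lia).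
  split; [now apply Rinv_0_lt_compat|].
  eapply Rle_lt_trans; [|exact HN].
  apply Rinv_le_contravar; [now apply lt_0_INR | apply le_INR; lia].
Qed.

Lemma is_Clim_components (u : nat -> C) (l : C) :
  (forall eps, 0 < eps -> exists N, forall n, (N <= n)%nat -> Rabs (Re (u n) - Re l) < eps) ->
  (forall eps, 0 < eps -> exists N, forall n, (N <= n)%nat -> Rabs (Im (u n) - Im l) < eps) ->
  is_Clim u l.
Proof.
  intros H1 H2 eps He.
  destruct (H1 (eps / 2)) as [N HN], (H2 (eps / 2)) as [M HM]; try lra.
  exists (N + M)%nat; intros n Hn; eapply Rle_lt_trans; [apply Cmod_le_re_im|].
  specialize (HN n ltac:(lia)); specialize (HM n ltac:(lia)).
  unfold Rminus in HN, HM; unfold Re, Im in *; simpl; lra.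
Qed.

Lemma is_Clim_continuous (f : C -> C) (w : C) :
  (forall u, continuous_C f u) -> is_Clim (fun n => f (RtoC (inv_nat n) * w)%C) (f 0).
Proof.
  intros Hf.
  assert (H : forall g : R -> R, continuous g 0 -> forall eps, 0 < eps ->
    exists N, forall n, (N <= n)%nat -> Rabs (g (inv_nat n) - g 0) < eps).
  { intros g Hg eps He.
    destruct (proj1 (filterlim_locally g (g 0)) Hg (mkposreal _ He)) as [d Hd].
    destruct (inv_nat_small d (cond_pos d)) as [N HN]; exists N; intros n Hn.
    apply Hd; specialize (HN n Hn).
    change (Rabs (inv_nat n - 0) < d); rewrite Rminus_0_r, Rabs_pos_eq; lra. }
  destruct (continuous_C_line f 0 w 0 Hf) as [C1 C2].
  assert (E : forall s : R, f (RtoC s * w)%C = f (0 + RtoC s * w)%C)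
    by (intros; now rewrite Cplus_0_l).
  replace (f 0) with (f (0 + RtoC 0 * w)%C) by (f_equal; ring).
  apply is_Clim_ext with (fun n => f (0 + RtoC (inv_nat n) * w)%C); [intros; now rewrite E|].
  apply is_Clim_components; [exact (H _ C1) | exact (H _ C2)].
Qed.

Lemma is_Clim_derive (g : R -> C) (l : C) :
  g 0 = 0 -> is_derive_C g 0 l -> is_Clim (fun n => RtoC (INR (S n)) * g (inv_nat n))%C l.
Proof.
  intros G0 [D1 D2].
  assert (H : forall (h : R -> R) k, h 0 = 0 -> is_derive h 0 k -> forall eps, 0 < eps ->
    exists N, forall n, (N <= n)%nat -> Rabs (INR (S n) * h (inv_nat n) - k) < eps).
  { intros h k H0 Hd eps He; apply is_derive_Reals in Hd.
    destruct (Hd eps He) as [d Hd'].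
    destruct (inv_nat_small d (cond_pos d)) as [N HN]; exists N; intros n Hn.
    specialize (HN n Hn).
    specialize (Hd' (inv_nat n) ltac:(lra) ltac:(rewrite Rabs_pos_eq; lra)).
    rewrite Rplus_0_l, H0, Rminus_0_r in Hd'.
    unfold inv_nat at 2 in Hd'; unfold Rdiv in Hd'; rewrite Rinv_inv, Rmult_comm in Hd'.
    exact Hd'. }
  apply is_Clim_components; intros eps He.
  - destruct (H _ _ (f_equal Re G0) D1 eps He) as [N HN]; exists N; intros n Hn.
    rewrite re_scal_l; auto.
  - destruct (H _ _ (f_equal Im G0) D2 eps He) as [N HN]; exists N; intros n Hn.
    rewrite im_scal_l; auto.
Qed.

(** The prefactor vanishes at 0 with slope $2\pi i a$ along the direction [a], so continuity of the
    Pochhammer factors suffices; hence a limit of quotients along [inv_nat] rather than a derivative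
    of [phi]. *)
Lemma phi_slope (tau a : C) :
  0 < Im tau ->
  is_Clim (fun n => RtoC (INR (S n)) * phi tau (RtoC (inv_nat n) * a))%C
    (RtoC (2 * PI) * Ci * a * qpoch_sq tau)%C.
Proof.
  intros Ht; assert (Hq := Cmod_nome _ Ht).
  set (s := fun t : R => (expk 1 (RtoC t * a) - expk (-1) (RtoC t * a))%C).
  set (P := fun u => (qpoch (expk 2 tau) (expk 2 (1 * u))
                      * qpoch (expk 2 tau) (expk (-2) (1 * u)))%C).
  apply is_Clim_ext with (fun n => (RtoC (INR (S n)) * s (inv_nat n)) * P (RtoC (inv_nat n) * a))%C.
  { intros n; unfold s, P, phi; rewrite !Cmult_1_l; ring. }
  apply is_Clim_mult.
  - apply is_Clim_derive.
    + unfold s; rewrite Cmult_0_l, !expk_0_arg; ring.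
    + assert (D : forall k : Z, is_derive_C (fun t => expk k (RtoC t * a)) 0
        (RtoC (IZR k) * (RtoC PI * Ci * a) * expk k (RtoC 0 * a))%C).
      { intros k; apply is_derive_C_Cexp; split; simpl; auto_derive; trivial;
          unfold Re, Im; simpl; ring. }
      assert (D' := is_derive_C_plus _ _ _ _ _ (D 1%Z)
        (is_derive_C_mult (fun _ => RtoC (-1)) _ 0 0 _
          (conj (is_derive_const (V := R_NormedModule) _ _)
                (is_derive_const (V := R_NormedModule) _ _)) (D (-1)%Z))).
      rewrite !Cmult_0_l, !expk_0_arg in D'.
      destruct D' as [D1 D2]; split.
      * replace (Re (RtoC (2 * PI) * Ci * a)%C) with
          (Re (1 * (RtoC PI * Ci * a) * 1 + (0 + -1 * (-1 * (RtoC PI * Ci * a) * 1)))%C)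
          by (unfold Re; simpl; ring).
        apply is_derive_ext with (2 := D1); intros; unfold s, Re; simpl; ring.
      * replace (Im (RtoC (2 * PI) * Ci * a)%C) with
          (Im (1 * (RtoC PI * Ci * a) * 1 + (0 + -1 * (-1 * (RtoC PI * Ci * a) * 1)))%C)
          by (unfold Im; simpl; ring).
        apply is_derive_ext with (2 := D2); intros; unfold s, Im; simpl; ring.
  - replace (qpoch_sq tau) with (P 0)
      by (unfold P, qpoch_sq; now rewrite Cmult_0_r, !expk_0_arg).
    apply is_Clim_continuous, limit_of_entire_continuous.
    now apply limit_of_entire_mult; apply limit_of_entire_qpoch_expk.
Qed.

(** * The modular transformation law *)

Definition psi (tau u : C) : C := (phi tau u / qpoch_sq tau)%C.

Lemma psi_opp (tau u : C) : psi tau (- u) = (- psi tau u)%C.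
Proof. unfold psi; rewrite phi_opp; unfold Cdiv; ring. Qed.

(** The sign $(-1)^m$ is written $e^{\pi im}$ so that it merges with the other exponentials. *)
Lemma psi_add_Z (tau u : C) (m : Z) :
  psi tau (u + RtoC (IZR m)) = (expk 1 (RtoC (IZR m)) * psi tau u)%C.
Proof.
  assert (H1 : expk 1 1 = (-1)%C) by exact (expk_odd_1 0).
  revert m; apply Z.bi_induction.
  - intros ? ? ->; reflexivity.
  - rewrite expk_0_arg, Cplus_0_r; ring.
  - intros m.
    assert (E : psi tau (u + RtoC (IZR (Z.succ m))) = (- psi tau (u + RtoC (IZR m)))%C).
    { rewrite succ_IZR, RtoC_plus, Cplus_assoc; unfold psi; rewrite phi_add_1.
      unfold Cdiv; ring. }
    assert (E' : expk 1 (RtoC (IZR (Z.succ m))) = (- expk 1 (RtoC (IZR m)))%C).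
    { rewrite succ_IZR, RtoC_plus, expk_plus_arg, H1; ring. }
    rewrite E, E'; split; intros H.
    + rewrite H; ring.
    + replace (psi tau (u + RtoC (IZR m))) with (- - psi tau (u + RtoC (IZR m)))%C by ring.
      rewrite H; ring.
Qed.

(** The quadratic term sums the arithmetic progression of the exponents $-(\tau+2u+2j\tau)$ of
    single steps, and the term $m$ collects their signs. *)
Lemma psi_add_tau_Z (tau u : C) (m : Z) :
  0 < Im tau ->
  psi tau (u + RtoC (IZR m) * tau)
  = (expk 1 (RtoC (IZR m) - RtoC (IZR m) * RtoC (IZR m) * tau - 2 * RtoC (IZR m) * u)
     * psi tau u)%C.
Proof.
  intros Ht.
  assert (H1 : expk 1 1 = (-1)%C) by exact (expk_odd_1 0).
  revert m; apply Z.bi_induction.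
  - intros ? ? ->; reflexivity.
  - replace (0 - 0 * 0 * tau - 2 * 0 * u)%C with (RtoC 0) by ring.
    rewrite expk_0_arg, Cmult_0_l, Cplus_0_r; ring.
  - intros m; set (M := RtoC (IZR m)).
    assert (E : psi tau (u + RtoC (IZR (Z.succ m)) * tau)
      = (- (expk (-1) (tau + ((u + M * tau) + (u + M * tau))) * psi tau (u + M * tau)))%C).
    { rewrite succ_IZR, RtoC_plus; fold M.
      replace (u + (M + 1) * tau)%C with ((u + M * tau) + tau)%C by ring.
      unfold psi; rewrite phi_add_tau by assumption; unfold Cdiv; ring. }
    assert (E' : expk 1 (RtoC (IZR (Z.succ m)) - RtoC (IZR (Z.succ m)) * RtoC (IZR (Z.succ m)) * tau
        - 2 * RtoC (IZR (Z.succ m)) * u)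
      = (- (expk (-1) (tau + ((u + M * tau) + (u + M * tau)))
            * expk 1 (M - M * M * tau - 2 * M * u)))%C).
    { rewrite succ_IZR, RtoC_plus; fold M.
      change (-1)%Z with (- (1))%Z; rewrite expk_opp, <- expk_opp_arg.
      replace (- (expk 1 (- (tau + (u + M * tau + (u + M * tau))))
                  * expk 1 (M - M * M * tau - 2 * M * u)))%C
        with (expk 1 1 * (expk 1 (- (tau + (u + M * tau + (u + M * tau))))
              * expk 1 (M - M * M * tau - 2 * M * u)))%C by (rewrite H1; ring).
      rewrite <- !expk_plus_arg; f_equal; ring. }
    rewrite E, E'; set (X := expk (-1) _); assert (X0 : X <> 0) by apply expk_neq_0.
    split; intros H.
    + rewrite H; ring.
    + replace (psi tau (u + M * tau)) with (- / X * - (X * psi tau (u + M * tau)))%C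
        by (field; assumption).
      rewrite H; field; assumption.
Qed.

(** In [phi] and [qpoch_sq] the variable [tau] enters only through $q$. *)
Lemma psi_T (tau u : C) (k : Z) : psi (tau + RtoC (IZR k)) u = psi tau u.
Proof.
  unfold psi, phi, qpoch_sq.
  rewrite expk_plus_arg, (expk_even_Z 1 k : expk 2 _ = _), Cmult_1_r; reflexivity.
Qed.

Lemma psi_S (tau u : C) :
  0 < Im tau ->
  psi (- / tau) (/ tau * u) = (/ tau * expk 1 (/ tau * (u * u)) * psi tau u)%C.
Proof.
  intros Ht; assert (Hs := Im_opp_inv _ Ht); assert (N := neq_0_of_Im _ Ht).
  assert (Q0 := qpoch_sq_neq_0 _ Ht); assert (Q1 := qpoch_sq_neq_0 _ Hs).
  assert (P0 : (RtoC (2 * PI) * Ci)%C <> 0).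
  { apply Cmult_neq_0; [|apply Ci_nz].
    intros E; apply (f_equal Re) in E; simpl in E; pose proof PI_RGT_0; lra. }
  assert (S1 := phi_slope tau 1 Ht).
  destruct (theta_like_proportional tau _ _ (theta_like_phi _ Ht) (theta_like_phi_inv _ Ht))
    as [k Hk].
  (* A nonzero slope forces a nonzero value at some $1/(n+1)$: a zero value would lie at distance
     exactly the modulus of the slope. *)
  { assert (L0 : (RtoC (2 * PI) * Ci * 1 * qpoch_sq tau)%C <> 0)
      by (rewrite Cmult_1_r; now apply Cmult_neq_0).
    destruct (S1 _ (proj1 (Cmod_gt_0 _) L0)) as [n Hn]; specialize (Hn n (le_n _)).
    exists (RtoC (inv_nat n) * 1)%C; intros E; rewrite E, Cmult_0_r in Hn.
    rewrite Cmod_minus_sym in Hn; unfold Cminus in Hn; rewrite Copp_0, Cplus_0_r in Hn; lra. }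
  (* Both sides are slopes at 0 of the same function; the Gaussian factor equals 1 there, and the
     inner division by [tau] rescales the slope. *)
  assert (K : (RtoC (2 * PI) * Ci * / tau * qpoch_sq (- / tau) * 1)%C
              = (k * (RtoC (2 * PI) * Ci * 1 * qpoch_sq tau))%C).
  { assert (X := is_Clim_continuous (fun u => expk (-1) (/ tau * (u * u))%C) 1
      (proj1 (entire_expk_sq _ _))).
    cbv beta in X; rewrite !Cmult_0_r, expk_0_arg in X.
    assert (Y := is_Clim_mult _ _ _ _ (phi_slope (- / tau) (/ tau) Hs) X).
    apply is_Clim_unique with (1 := Y).
    apply is_Clim_ext with (2 := is_Clim_mult _ _ _ _ (is_Clim_const k) S1).
    intros n; specialize (Hk (RtoC (inv_nat n) * 1)%C); cbv beta in Hk.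
    replace (/ tau * (RtoC (inv_nat n) * 1))%C with (RtoC (inv_nat n) * / tau)%C in Hk by ring.
    transitivity (RtoC (INR (S n)) * (k * phi tau (RtoC (inv_nat n) * 1)))%C; [ring|].
    rewrite <- Hk; ring. }
  (* The ratio of the two normalising constants disappears in [psi], leaving $1/\tau$. *)
  assert (Ek : k = (/ tau * qpoch_sq (- / tau) / qpoch_sq tau)%C).
  { replace k with (k * (RtoC (2 * PI) * Ci * 1 * qpoch_sq tau)
      * / (RtoC (2 * PI) * Ci) * / qpoch_sq tau)%C
      by (field; repeat split; auto; intros E; apply P0; rewrite E; ring).
    rewrite <- K; field; repeat split; auto; intros E; apply P0; rewrite E; ring. }
  specialize (Hk u); cbv beta in Hk.
  assert (X0 := expk_neq_0 1 (/ tau * (u * u))).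
  change (-1)%Z with (- (1))%Z in Hk; rewrite expk_opp, Ek in Hk.
  unfold psi.
  replace (phi (- / tau) (/ tau * u)) with
    (phi (- / tau) (/ tau * u) * / expk 1 (/ tau * (u * u)) * expk 1 (/ tau * (u * u)))%C
    by (field; assumption).
  rewrite Hk; field; auto.
Qed.

Lemma den_neq_0 (a b c d : Z) (tau : C) :
  (a * d - b * c = 1)%Z -> 0 < Im tau -> (RtoC (IZR c) * tau + RtoC (IZR d))%C <> 0.
Proof.
  intros H Ht E.
  assert (E1 := f_equal Re E); assert (E2 := f_equal Im E).
  unfold Re, Im in *; simpl in E1, E2.
  assert (C0 : IZR c = 0) by nra.
  rewrite C0 in E1; assert (D0 : IZR d = 0) by lra.
  apply eq_IZR in C0; apply eq_IZR in D0; subst; lia.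
Qed.

Lemma psi_modular (a b c d : Z) (tau u : C) :
  (a * d - b * c = 1)%Z -> 0 < Im tau ->
  let den := (RtoC (IZR c) * tau + RtoC (IZR d))%C in
  psi ((RtoC (IZR a) * tau + RtoC (IZR b)) / den) (u / den)
  = (/ den * expk 1 (RtoC (IZR c) * (u * u) / den) * psi tau u)%C.
Proof.
  assert (G : forall n a b c d tau u, Z.abs_nat c = n ->
    (a * d - b * c = 1)%Z -> 0 < Im tau ->
    let den := (RtoC (IZR c) * tau + RtoC (IZR d))%C in
    psi ((RtoC (IZR a) * tau + RtoC (IZR b)) / den) (u / den)
    = (/ den * expk 1 (RtoC (IZR c) * (u * u) / den) * psi tau u)%C);
    [|eauto].
  clear; intros n; induction n as [n IH] using lt_wf_ind; intros a b c d tau u Hn Hdet Ht den.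
  assert (D0 : den <> 0) by now apply (den_neq_0 a b).
  destruct (Z.eq_dec c 0) as [->|C0].
  (* With $c=0$ the matrix is a translation up to sign, and the sign is absorbed by the oddness of
     [psi]. *)
  - assert (Had : (a * d = 1)%Z) by lia.
    unfold den; destruct (Z.eq_mul_1 a d Had) as [-> | Ha].
    + assert (d = 1)%Z as -> by lia.
      replace ((1 * tau + RtoC (IZR b)) / (0 * tau + 1))%C with (tau + RtoC (IZR b))%C
        by (field; intros E; apply C1_nz; rewrite <- E; ring).
      replace (u / (0 * tau + 1))%C with u
        by (field; intros E; apply C1_nz; rewrite <- E; ring).
      replace (0 * (u * u) / (0 * tau + 1))%C with (RtoC 0)
        by (field; intros E; apply C1_nz; rewrite <- E; ring).
      rewrite psi_T, expk_0_arg, Cmult_0_l, Cplus_0_l; field; apply C1_nz.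
    + assert (a = -1)%Z as -> by lia; assert (d = -1)%Z as -> by lia.
      assert (M : (0 * tau + -1 = - (1))%C) by ring.
      rewrite M.
      replace ((-1 * tau + RtoC (IZR b)) / - (1))%C with (tau + RtoC (IZR (- b)))%C
        by (rewrite opp_IZR, RtoC_opp; field; intros E; apply D0; unfold den; rewrite M, <- E; ring).
      assert (M' : (- (1))%C <> 0) by (rewrite <- M; exact D0).
      replace (u / - (1))%C with (- u)%C by (field; assumption).
      replace (0 * (u * u) / - (1))%C with (RtoC 0) by (field; assumption).
      rewrite psi_T, psi_opp, expk_0_arg; field; assumption.
  (* With $s=\tau-k$, the same point is the image of $-1/s$ under the matrix with rows $(ak+b,-a)$
     and $(ck+d,-c)$, which is $AT^kS$; this [k] makes its lower left entry [d mod c], smaller than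
     [c] in absolute value. *)
  - set (k := (- (d / c))%Z).
    assert (Hk : (c * k + d = d mod c)%Z)
      by (unfold k; pose proof (Z.div_mod d c C0); nia).
    set (s := (tau + RtoC (IZR (- k)))%C).
    assert (Hs : 0 < Im s) by (unfold s, Im in *; simpl; lra).
    assert (S0 := neq_0_of_Im _ Hs).
    assert (Et : tau = (s + RtoC (IZR k))%C) by (unfold s; rewrite opp_IZR, RtoC_opp; ring).
    assert (I := IH (Z.abs_nat (c * k + d)) ltac:(
        rewrite Hk, <- Hn; pose proof (Z.mod_bound_or d c C0); lia)
      (a * k + b)%Z (- a)%Z (c * k + d)%Z (- c)%Z (- / s)%C (- (/ s * u))%C
      eq_refl ltac:(nia) (Im_opp_inv _ Hs)); cbv zeta in I.
    rewrite psi_opp, psi_S in I by assumption.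
    replace (psi s u) with (psi tau u) in I by (symmetry; apply psi_T).
    assert (Ed : (RtoC (IZR (c * k + d)) * (- / s) + RtoC (IZR (- c)))%C = (- (den / s))%C).
    { unfold den; rewrite Et, plus_IZR, mult_IZR, opp_IZR, RtoC_plus, RtoC_mult, RtoC_opp.
      field; assumption. }
    assert (Ed0 : (den / s)%C <> 0)
      by (unfold Cdiv; apply Cmult_neq_0; [exact D0|];
          intros E; apply C1_nz; rewrite <- (Cinv_r s), E by assumption; ring).
    rewrite Ed in I.
    replace ((RtoC (IZR (a * k + b)) * - / s + RtoC (IZR (- a))) / - (den / s))%C
      with ((RtoC (IZR a) * tau + RtoC (IZR b)) / den)%C in I.
    2:{ rewrite Et, plus_IZR, mult_IZR, opp_IZR, RtoC_plus, RtoC_mult, RtoC_opp.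
        field; auto. }
    replace (- (/ s * u) / - (den / s))%C with (u / den)%C in I by (field; auto).
    rewrite I.
    (* Cocycle rule for the exponents: the one for the given matrix is the one for the reduced
       matrix at $-u/s$ plus $u^2/s$ from the inversion. *)
    assert (Ee : (RtoC (IZR c) * (u * u) / den)%C
      = (RtoC (IZR (c * k + d)) * (- (/ s * u) * - (/ s * u)) / - (den / s) + / s * (u * u))%C).
    { transitivity ((den - RtoC (IZR (c * k + d))) / (s * den) * (u * u))%C.
      - unfold den; rewrite Et, plus_IZR, mult_IZR, RtoC_plus, RtoC_mult; field.
        split; [|assumption]. unfold den in D0; now rewrite Et in D0.
      - field; auto. }
    rewrite Ee, expk_plus_arg; field; auto.
Qed.

(** * Eta quotients *)

Lemma Im_moebius_pos (a b c d : Z) (z : C) :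
  (a * d - b * c = 1)%Z -> 0 < Im z ->
  0 < Im ((RtoC (IZR a) * z + RtoC (IZR b)) / (RtoC (IZR c) * z + RtoC (IZR d)))%C.
Proof.
  intros Hdet Hz; assert (D0 := den_neq_0 a b c d z Hdet Hz).
  apply Cmod_gt_0 in D0; apply (pow_lt _ 2) in D0; rewrite Cmod2_alt in D0.
  apply (f_equal IZR) in Hdet; rewrite minus_IZR, !mult_IZR in Hdet.
  unfold Re, Im in *; simpl in *.
  set (A := IZR a) in *; set (B := IZR b) in *; set (X := IZR c) in *; set (D := IZR d) in *.
  set (x := fst z) in *; set (y := snd z) in *.
  match goal with |- 0 < ?e => replace e with
    ((A * D - B * X) * y / ((X * x + D) * (X * x + D) + X * y * (X * y))) end.
  - rewrite Hdet, Rmult_1_l; apply Rdiv_lt_0_compat; [assumption|nra].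
  - field; nra.
Qed.

Lemma Cinfprod_ext (f g : nat -> C) :
  (forall m, (1 <= m)%nat -> f m = g m) -> Cinfprod f = Cinfprod g.
Proof.
  intros E; apply C_ext; simpl; f_equal; apply Lim_seq_ext; intros n;
    now rewrite (Cprod1_ext f g n E).
Qed.

Lemma qpow_INR (n : nat) (z : C) : qpow (INR n) z = (expk 2 z ^ n)%C.
Proof.
  unfold qpow, expk; rewrite Cexp_pow; f_equal; rewrite !RtoC_mult; ring.
Qed.

Lemma qpow_plus (r s : R) (z : C) : qpow (r + s) z = (qpow r z * qpow s z)%C.
Proof.
  unfold qpow; rewrite <- Cexp_plus; f_equal; rewrite !RtoC_mult, RtoC_plus; ring.
Qed.

Lemma eta_sq (z : C) : (eta z * eta z)%C = (qpow (1 / 12) z * qpoch_sq z)%C.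
Proof.
  unfold eta, qpoch_sq.
  replace (1 / 12) with (1 / 24 + 1 / 24) by field; rewrite qpow_plus.
  replace (Cinfprod (fun n => 1 - qpow (INR n) z)%C) with (qpoch (expk 2 z) 1); [ring|].
  apply Cinfprod_ext; intros; rewrite qpow_INR; ring.
Qed.

Lemma zetap_expk (p : nat) (h : R) : zetap p h = expk 2 (RtoC (h / INR p)).
Proof.
  unfold zetap, expk; f_equal.
  replace (2 * PI * h / INR p) with (2 * PI * (h / INR p)) by (unfold Rdiv; ring).
  rewrite !RtoC_mult; ring.
Qed.

(** With $u=h/p$, the identity $1-e^{2\pi iu}=-e^{\pi iu}(e^{\pi iu}-e^{-\pi iu})$ turns the factor
    of exponent 0 into the prefactor of [phi], and $B(0)/2=1/12$ matches the power of $q$ in [eta]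
    squared. *)
Lemma Egen_0_phi (p : nat) (h : R) (z : C) :
  0 < Im z ->
  Egen p 0 h z
  = (qpow (1 / 12) z * (- (expk 1 (RtoC (h / INR p)) * phi z (RtoC (h / INR p)))))%C.
Proof.
  intros Hz; assert (Hq := Cmod_nome _ Hz).
  set (u := RtoC (h / INR p)); set (q := expk 2 z) in *.
  assert (E : Cinfprod (fun m => (1 - zetap p h * qpow (INR m - 1 + 0 / INR p) z)
      * (1 - zetap p (- h) * qpow (INR m - 0 / INR p) z))%C
    = ((1 - expk 2 u) * qpoch q (expk 2 u) * qpoch q (expk (-2) u))%C).
  { rewrite (Cinfprod_ext _ (fun m => (1 - expk 2 u * q ^ (m - 1)) * (1 - expk (-2) u * q ^ m))%C).
    - set (f := fun m => ((1 - expk 2 u * q ^ (m - 1)) * (1 - expk (-2) u * q ^ m))%C).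
      (* The first half of the product starts at exponent 0; splitting off that factor takes at
         least one term, so the limit is taken along [S n]. *)
      assert (L : is_Clim (fun n => Cprod1 f (S n))
        ((1 - expk 2 u) * qpoch q (expk 2 u) * qpoch q (expk (-2) u))%C).
      { apply is_Clim_ext with (fun n => (1 - expk 2 u) * Cprod1 (fun m => 1 - expk 2 u * q ^ m)%C n
          * Cprod1 (fun m => 1 - expk (-2) u * q ^ m)%C (S n))%C.
        - intros n; unfold f; rewrite Cprod1_mult; f_equal; rewrite Cprod1_S_l; f_equal.
          + simpl; ring.
          + apply Cprod1_ext; intros m _; do 3 f_equal; lia.
        - repeat apply is_Clim_mult; [apply is_Clim_const | now apply is_Clim_qpoch |].
          now apply (is_Clim_S (Cprod1 (fun m => 1 - expk (-2) u * q ^ m)%C)), is_Clim_qpoch. }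
      apply is_Clim_Clim; intros eps He; destruct (L eps He) as [N HN].
      exists (S N); intros [|n] Hn; [lia | apply HN; lia].
    - intros m Hm; rewrite !zetap_expk; fold u.
      replace (RtoC (- h / INR p)) with (- u)%C
        by (unfold u; rewrite <- RtoC_opp; f_equal; unfold Rdiv; ring).
      rewrite expk_opp_arg, <- expk_opp.
      replace (INR m - 1 + 0 / INR p) with (INR (m - 1))
        by (rewrite minus_INR by assumption; simpl; unfold Rdiv; ring).
      replace (INR m - 0 / INR p) with (INR m) by (unfold Rdiv; ring).
      rewrite !qpow_INR; reflexivity. }
  unfold Egen; rewrite E.
  replace (Bpoly (0 / INR p) / 2) with (1 / 12) by (unfold Bpoly, Rdiv; rewrite !Rmult_0_l; field).
  f_equal; unfold phi; fold q.
  change 2%Z with (1 + 1)%Z at 1; change (-1)%Z with (- (1))%Z.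
  rewrite expk_plus, expk_opp; field; apply expk_neq_0.
Qed.

Lemma F1_psi (p l : nat) (z : C) :
  0 < Im z ->
  F1 p l z = (- (expk (-1) (RtoC (INR l / INR p)) * / psi z (RtoC (INR l / INR p))))%C.
Proof.
  intros Hz; unfold F1; rewrite eta_sq, Egen_0_phi by assumption.
  set (u := RtoC (INR l / INR p)).
  unfold psi, Cdiv; rewrite !Cinv_mult.
  change (-1)%Z with (- (1))%Z; rewrite expk_opp.
  replace (- (expk 1 u * phi z u))%C with ((-1) * expk 1 u * phi z u)%C by ring.
  rewrite !Cinv_mult.
  assert (Q := qpoch_sq_neq_0 z Hz).
  assert (W : qpow (1 / 12) z <> 0) by apply Cexp_neq_0.
  assert (M : (-1)%C <> 0) by (intros E; apply C1_nz; transitivity (-(-1))%C; [ring|rewrite E; ring]).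
  (* Naming the reciprocal makes it an atom for [field], which then asks nothing about zeros of
     [phi]. *)
  set (X := (/ phi z u)%C).
  field; repeat split; auto; apply expk_neq_0.
Qed.

Lemma Cexp_PI_expk (x : R) : Cexp (RtoC (PI * x) * Ci) = expk 1 (RtoC x).
Proof. unfold expk; f_equal; rewrite RtoC_mult; ring. Qed.

Theorem theorem2p2 (p l : nat) (a b c d : Z) :
  prime (Z.of_nat p) -> (3 < p)%nat ->
  (1 <= l)%nat -> (l <= p - 1)%nat ->
  (a * d - b * c = 1)%Z -> (Z.of_nat p | c)%Z ->
  forall z : C, (0 < Im z)%R ->
    slash1 (F1 p l) a b c d z = Cmult (muA p l c d) (F1 p (resid p l d) z).
Proof.
  intros _ Hp _ _ Hdet [e He] z Hz.
  assert (P0 : INR p <> 0) by (apply not_0_INR; lia).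
  unfold slash1; set (den := (RtoC (IZR c) * z + RtoC (IZR d))%C).
  assert (D0 : den <> 0) by now apply (den_neq_0 a b).
  rewrite (F1_psi p l) by now apply Im_moebius_pos.
  rewrite (F1_psi p (resid p l d)) by assumption.
  set (u := INR l / INR p).
  (* [m] is $c\ell/p$, an integer by divisibility; [k] is the quotient of $d\ell$ by [p], and [t]
     the residue divided by [p]. *)
  set (m := (Z.of_nat l * e)%Z).
  set (k := (d * Z.of_nat l / Z.of_nat p)%Z).
  set (t := INR (resid p l d) / INR p).
  assert (Ec : IZR c * u = IZR m).
  { unfold u, m; rewrite He, !mult_IZR, <- !INR_IZR_INZ; field; assumption. }
  assert (Ed : IZR d * u = t + IZR k).
  { assert (E := Z.div_mod (d * Z.of_nat l) (Z.of_nat p) ltac:(lia)); fold k in E.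
    unfold t, u, resid; rewrite !INR_IZR_INZ, Z2Nat.id
      by (apply Z.mod_pos_bound; lia).
    rewrite INR_IZR_INZ in P0.
    apply (f_equal IZR) in E; rewrite plus_IZR, !mult_IZR in E.
    apply Rmult_eq_reg_r with (IZR (Z.of_nat p)); [|assumption].
    replace (IZR d * (IZR (Z.of_nat l) / IZR (Z.of_nat p)) * IZR (Z.of_nat p))
      with (IZR d * IZR (Z.of_nat l)) by (field; assumption).
    rewrite E; field; assumption. }
  assert (M := psi_modular a b c d z (RtoC u * den) Hdet Hz); cbv zeta in M; fold den in M.
  replace (RtoC u * den / den)%C with (RtoC u) in M by (field; assumption).
  replace (RtoC (IZR c) * (RtoC u * den * (RtoC u * den)) / den)%C
    with (RtoC (IZR m) * (RtoC u * den))%C in M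
    by (rewrite <- Ec, RtoC_mult; field; assumption).
  rewrite M; clear M.
  replace (RtoC u * den)%C with (RtoC t + RtoC (IZR k) + RtoC (IZR m) * z)%C
    by (rewrite <- RtoC_plus, <- Ed, <- Ec, !RtoC_mult; unfold den; ring).
  rewrite psi_add_tau_Z, psi_add_Z by assumption.
  rewrite !Cinv_mult.
  unfold muA; cbv zeta; rewrite Cexp_PI_expk.
  change (-1)%Z with (- (1))%Z; rewrite !expk_opp, <- !expk_opp_arg.
  set (X := (/ psi z (RtoC t))%C).
  (* In terms of $u=\ell/p$ the exponent of [muA] is $du-u+(cu)(du)-cu$, where $cu=m$ and
     $du=t+k$. *)
  replace (expk 1 (RtoC (INR l * (IZR d - 1) / INR p + IZR c * IZR d * INR l ^ 2 / INR p ^ 2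
      - IZR c * INR l / INR p))) with
    (expk 1 (RtoC (IZR d * u - u + IZR c * u * (IZR d * u) - IZR c * u)))
    by (do 2 f_equal; unfold u; field; assumption).
  rewrite Ec, Ed.
  (* The translation by [k] contributes $e^{-\pi ik}$ while [muA] contains $e^{\pi ik}$; both are
     the same sign. *)
  assert (K2 : (expk 1 (RtoC (IZR k)) * expk 1 (RtoC (IZR k)))%C = 1).
  { rewrite <- expk_plus; exact (expk_even_Z 1 k). }
  set (T := RtoC t); set (K := RtoC (IZR k)) in *; set (m' := RtoC (IZR m)).
  (* The dependence on [z] cancels: $-m^2z$ from the modular law against $m^2z$ from the translation
     by $mz$. *)
  assert (E : (expk 1 (- RtoC u) * (expk 1 (- (m' * (T + K + m' * z)))
      * (expk 1 (- (m' - m' * m' * z - 2 * m' * (T + K))) * expk 1 (- K))))%C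
    = (expk 1 (RtoC (t + IZR k - u + IZR m * (t + IZR k) - IZR m)) * expk 1 (- T))%C).
  { transitivity (expk 1 (- RtoC u + m' * (T + K) - m' - K) * (expk 1 K * expk 1 K))%C.
    - rewrite K2, Cmult_1_r, <- !expk_plus_arg; f_equal; ring.
    - rewrite <- !expk_plus_arg, RtoC_minus, RtoC_plus, RtoC_mult, RtoC_minus, RtoC_plus.
      fold T K m'; f_equal; ring. }
  transitivity (- ((expk 1 (- RtoC u) * (expk 1 (- (m' * (T + K + m' * z)))
      * (expk 1 (- (m' - m' * m' * z - 2 * m' * (T + K))) * expk 1 (- K)))) * X))%C.
  - field; assumption.
  - rewrite E; ring.
Qed.
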